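(* Let $(X,\mathbb X)\in\mathcal D^\gamma([0,T],\mathbb R^n)$ with $\gamma>\frac13$ be such that $X$ is $\theta$-H\''older rough with $2\gamma>\theta$. Let $(A,A')\in\mathcal C_X^\gamma([0,T],\mathbb R^{mn})$ and $B\in\mathcal C^\gamma([0,T],\mathbb R^m)$, and set $$Z_t=\int_0^tA_s\,dX_s+\int_0^tB_s\,ds .$$ Then there exist constants $r>0$ and $q>0$ such that, setting $$\mathcal R=1+L_\theta(X)^{-1}+\|(X,\mathbb X)\|_\gamma+\|(A,A')\|_{X,\gamma}+\|B\|_{\mathcal C^\gamma},$$ one has the bound $$\|A\|_\infty+\|B\|_\infty\le M\,\mathcal R^q\,\|Z\|_\infty^r$$ for a constant $M$ depending only on $T$, $m$ and $n$.
   Context: The parameters $\gamma\in(\frac13,\frac12]$ and $\theta\in(0,1)$ are fixed. For $f$ on $[0,T]$ write $\delta f_{st}=f_t-f_s$, $\|f\|_\infty=\sup_t|f_t|$, $\|f\|_\gamma=\sup_{s\ne t}|\delta f_{st}|/|t-s|^\gamma$, $\|f\|_{\mathcal C^\gamma}=\|f\|_\infty+\|f\|_\gamma$, and $\mathcal C^\gamma$ for the functions with finite such norm; for continuous $R:[0,T]^2\to\mathbb R^k$ vanishing on the diagonal, $\|R\|_{2\gamma}=\sup_{s\ne t}|R_{st}|/|t-s|^{2\gamma}$. $\mathcal D^\gamma([0,T],\mathbb R^n)$ is the set of pairs $(X,\mathbb X)$ with $X:[0,T]\to\mathbb R^n$, $\mathbb X:[0,T]^2\to\mathbb R^{n\times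 n}$ continuous, $\mathbb X_{st}^{ij}-\mathbb X_{ut}^{ij}-\mathbb X_{su}^{ij}=\delta X^i_{su}\,\delta X^j_{ut}$ for all $s,u,t,i,j$, and $\|(X,\mathbb X)\|_\gamma:=\|X\|_\gamma+\|\mathbb X\|_{2\gamma}<\infty$. $\mathcal C_X^\gamma([0,T],\mathbb R^k)$ is the set of pairs $(Y,Y')$ with $Y\in\mathcal C^\gamma([0,T],\mathbb R^k)$, $Y'\in\mathcal C^\gamma([0,T],\mathbb R^{k\times n})$ and $R^Y_{st}:=\delta Y_{st}-Y'_s\,\delta X_{st}$ satisfying $\|R^Y\|_{2\gamma}<\infty$; its norm is $\|(Y,Y')\|_{X,\gamma}=|Y_0|+\|Y'\|_{\mathcal C^\gamma}+\|R^Y\|_{2\gamma}$. Here $\mathbb R^{mn}$ is identified with $m\times n$ matrices, and the integral is, componentwise, $\big(\int_0^tA_s\,dX_s\big)^i=\lim_{|P|\to0}\sum_{[u,v]\in P}\big(\sum_jA^{ij}_u\,\delta X^j_{uv}+\sum_{j,k}(A'_u)^{ij,k}\,\mathbb X^{kj}_{uv}\big)$ over partitions $P$ of $[0,t]$ (the limit exists). A path $X$ in $\mathbb R^n$ is $\theta$-H\''older rough on $[0,T]$, $\theta\in(0,1)$, if there is a constant $L>0$ such that for every $s\in[0,T]$, every $\varepsilon\in(0,T/2]$ and every $\phi\in\mathbb R^n$ with $\|\phi\|=1$ there exists $t\in[0,T]$ with $|t-s|\le\varepsilon$ and $|\langle\phi,\delta X_{st}\rangle|>L\varepsilon^\theta$.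 The largest such $L$ (the supremum) is denoted $L_\theta(X)$. *)

(* Defs.v *)
From HB Require Import structures.
From mathcomp Require Export all_boot all_order all_algebra.
From mathcomp Require Export all_classical all_reals all_analysis.
Set Implicit Arguments.
Unset Strict Implicit.
Unset Printing Implicit Defensive.
Export Order.TTheory GRing.Theory Num.Theory.
Export numFieldNormedType.Exports.

Local Open Scope classical_set_scope.
Local Open Scope ring_scope.

(* A path on [0, T] is a total function on R: every notion below looks at its
   values on [0, T] only. Norms and suprema live in the extended reals, so that
   "finite norm" reads "< +oo". *)

(* The Euclidean norm (Frobenius on matrices, R^(p x q) being seen as R^(pq));
   the library norm `|M| on matrices is the max norm. *)
Definition enorm (R : realType) (p q : nat) (M : 'M[R]_(p, q)) : R :=
  Num.sqrt (\sum_(i < p) \sum_(j < q) M i j ^+ 2).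

Definition increment (R : realType) (p q : nat) (f : R -> 'M[R]_(p, q))
  (s t : R) : 'M[R]_(p, q) := f t - f s.

Definition supnorm (R : realType) (p q : nat) (T : R)
    (f : R -> 'M[R]_(p, q)) : \bar R :=
  ereal_sup [set (enorm (f t))%:E | t in `[0, T]].

Definition holder2 (R : realType) (p q : nat) (T alpha : R)
    (F : R -> R -> 'M[R]_(p, q)) : \bar R :=
  ereal_sup [set (enorm (F st.1 st.2) / `|st.2 - st.1| `^ alpha)%:E
            | st in [set st : R * R |
                      [/\ st.1 \in `[0, T], st.2 \in `[0, T] & st.1 != st.2]]].

Definition holder (R : realType) (p q : nat) (T alpha : R)
    (f : R -> 'M[R]_(p, q)) : \bar R := holder2 T alpha (increment f).

Definition holder_norm (R : realType) (p q : nat) (T alpha : R)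
    (f : R -> 'M[R]_(p, q)) : \bar R := (supnorm T f + holder T alpha f)%E.

Definition rough_path_norm (R : realType) (n : nat) (T gamma : R)
    (X : R -> 'cV[R]_n) (XX : R -> R -> 'M[R]_n) : \bar R :=
  (holder T gamma X + holder2 T (2 * gamma) XX)%E.

Definition rough_path (R : realType) (n : nat) (T gamma : R)
    (X : R -> 'cV[R]_n) (XX : R -> R -> 'M[R]_n) : Prop :=
  [/\ {within `[0, T], continuous X},
      {within `[0, T] `*` `[0, T], continuous (fun st : R * R => XX st.1 st.2)},
      (forall s u t : R, s \in `[0, T] -> u \in `[0, T] -> t \in `[0, T] ->
         forall i j, XX s t i j - XX u t i j - XX s u i j =
                     increment X s u i 0 * increment X u t j 0) &
      (rough_path_norm T gamma X XX < +oo)%E].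

Definition remainder (R : realType) (n k : nat) (X : R -> 'cV[R]_n)
    (Y : R -> 'cV[R]_k) (Y' : R -> 'M[R]_(k, n)) (s t : R) : 'cV[R]_k :=
  increment Y s t - Y' s *m increment X s t.

Definition controlled (R : realType) (n k : nat) (T gamma : R)
    (X : R -> 'cV[R]_n) (Y : R -> 'cV[R]_k) (Y' : R -> 'M[R]_(k, n)) : Prop :=
  [/\ (holder_norm T gamma Y < +oo)%E,
      (holder_norm T gamma Y' < +oo)%E &
      (holder2 T (2 * gamma) (remainder X Y Y') < +oo)%E].

Definition controlled_norm (R : realType) (n k : nat) (T gamma : R)
    (X : R -> 'cV[R]_n) (Y : R -> 'cV[R]_k) (Y' : R -> 'M[R]_(k, n)) : \bar R :=
  ((enorm (Y 0))%:E + holder_norm T gamma Y' +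
   holder2 T (2 * gamma) (remainder X Y Y'))%E.

(* The identification of m x n matrices with R^(mn): the entry (i, j) is the
   coordinate mxvec_index i j. *)
Definition flatten_path (R : realType) (m n : nat) (A : R -> 'M[R]_(m, n)) :
  R -> 'cV[R]_(m * n) := fun t => (mxvec (A t))^T.

(* As for itv_partition, the left endpoint a of the partition is not listed
   in s; the intervals [u, v] of the partition are the pairs (u, v) in
   subintervals a s. *)
Definition subintervals (R : realType) (a : R) (s : seq R) : seq (R * R) :=
  zip (a :: s) s.

Definition mesh (R : realType) (a : R) (s : seq R) : R :=
  \big[Num.max/0]_(uv <- subintervals a s) (uv.2 - uv.1).

Definition mesh_filter (R : realType) (a b : R) : set_system (seq R) :=
  filter_from [set e : R | 0 < e]
    (fun e => [set s | itv_partition a b s /\ mesh a s < e]).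

Definition rough_integral (R : realType) (m n : nat)
    (X : R -> 'cV[R]_n) (XX : R -> R -> 'M[R]_n)
    (A : R -> 'M[R]_(m, n)) (A' : R -> 'M[R]_(m * n, n)) (t : R) : 'cV[R]_m :=
  \col_i lim ((fun s : seq R =>
      \sum_(uv <- subintervals 0 s)
        (\sum_j A uv.1 i j * increment X uv.1 uv.2 j 0 +
         \sum_j \sum_k A' uv.1 (mxvec_index i j) k * XX uv.1 uv.2 k j))
    @ mesh_filter 0 t).

Definition time_integral (R : realType) (m : nat) (B : R -> 'cV[R]_m) (t : R) :
    'cV[R]_m :=
  \col_i (\int[lebesgue_measure]_(s in `[0, t]) B s i 0).

Definition rough_with (R : realType) (n : nat) (T theta : R)
    (X : R -> 'cV[R]_n) (L : R) : Prop :=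
  forall (s eps : R) (phi : 'cV[R]_n),
    s \in `[0, T] -> 0 < eps <= T / 2 -> enorm phi = 1 ->
    exists t : R, [/\ t \in `[0, T], `|t - s| <= eps &
      `|\sum_i phi i 0 * increment X s t i 0| > L * eps `^ theta].

Definition holder_rough (R : realType) (n : nat) (T theta : R)
    (X : R -> 'cV[R]_n) : Prop :=
  exists L : R, 0 < L /\ rough_with T theta X L.

Definition roughness (R : realType) (n : nat) (T theta : R)
    (X : R -> 'cV[R]_n) : \bar R :=
  ereal_sup [set L%:E | L in [set L : R | 0 < L /\ rough_with T theta X L]].

(* Main.v *)
From mathcomp Require Import ring lra.
Require Import Defs.

Set Implicit Arguments.
Unset Strict Implicit.
Unset Printing Implicit Defensive.

Local Open Scope classical_set_scope.
Local Open Scope ring_scope.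

(** The proof separates the scales of the three contributions to an increment
of Z. Over a short time h, the increment of the rough integral is the germ
A_s dX + A'_s XX up to an error of order h^(3 gamma), where 3 gamma > 1; the
area term A'_s XX is of order h^(2 gamma), and the drift contributes at most
order h, hence also h^(2 gamma). So A_s dX is bounded by 2 |Z| + C h^(2 gamma).
Hoelder roughness says that X moves by at least L h^theta in every direction,
in particular in that of a row of A_s, and therefore
|A_s| <= C (|Z| h^(-theta) + h^(2 gamma - theta)) for every small h.
As 2 gamma > theta, choosing h as a power of |Z| bounds A by a power of |Z|.

The same reasoning is then repeated. The Gubinelli derivative A' is the
coefficient of A along X, with a remainder of order h^(2 gamma), so smallness
of A and roughness make A' small. With A and A' small, cutting [0, T] into
steps of length of order h bounds the integral of A against X by
C ((|A| + |A'|) / h + h^(3 gamma - 1)), which makes it small; hence so is the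
integral of B, and since B is Hoelder continuous B itself is small.

All four steps end with the same optimisation over h (lemma interpolation):
after weakening the exponents to a common k > 0, each of them turns a bound
D <= C z^t into one of the form C' z^(t s) with s = k / (1 + k). The final
exponents are therefore r = s^4, and q = 11 counts the powers of the norm
lost on the way (lemma row_estimate).

That the compensated Riemann sums converge at all, and that their limit is
close to the germ, is the sewing lemma (sewing, riemann_sum_lim). Each row of A is
treated separately, so that the integrals are real-valued. *)

(** * Riemann sums of almost additive functions *)

Definition riemann_sum (R : realType) (Xi : R -> R -> R) (a : R) (s : seq R) : R :=
  \sum_(uv <- subintervals a s) Xi uv.1 uv.2.

Lemma riemann_sum_nil (R : realType) (Xi : R -> R -> R) (a : R) :
  riemann_sum Xi a [::] = 0.
Proof. by rewrite /riemann_sum big_nil. Qed.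

Lemma riemann_sum_cons (R : realType) (Xi : R -> R -> R) (a x : R) (s : seq R) :
  riemann_sum Xi a (x :: s) = Xi a x + riemann_sum Xi x s.
Proof. by rewrite /riemann_sum big_cons. Qed.

Lemma riemann_sum_cat (R : realType) (Xi : R -> R -> R) (a : R) (s1 s2 : seq R) :
  riemann_sum Xi a (s1 ++ s2) =
  riemann_sum Xi a s1 + riemann_sum Xi (last a s1) s2.
Proof.
elim: s1 a => [|x s1 ih] a /=; first by rewrite riemann_sum_nil add0r.
by rewrite !riemann_sum_cons ih addrA.
Qed.

Lemma mesh_cons (R : realType) (a x : R) (s : seq R) :
  mesh a (x :: s) = Num.max (x - a) (mesh x s).
Proof. by rewrite /mesh big_cons. Qed.

Lemma split_at_threshold (R : realType) (a c : R) (s : seq R) :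
  a <= c -> c < last a s ->
  exists s1 x s2, [/\ s = s1 ++ x :: s2, last a s1 <= c & c < x].
Proof.
elim: s a => [|y s ih] a ac /=; first by move=> /(le_lt_trans ac); rewrite ltxx.
case: (lerP y c) => [yc cl|cy _]; last by exists [::], y, s.
have [s1 [x [s2 [-> ls cx]]]] := ih _ yc cl.
by exists (y :: s1), x, s2.
Qed.

Definition almost_additive (R : realType) (T K p : R) (Xi : R -> R -> R) : Prop :=
  forall s u t : R, 0 <= s -> s <= u -> u <= t -> t <= T ->
    `|Xi s t - Xi s u - Xi u t| <= K * (t - s) `^ p.

(** The solution C of C = C 2^(1-p) + 2: cutting a partition at its middle costs
two defects and leaves two halves, each contributing C 2^(-p). *)
Definition sewing_cst (R : realType) (p : R) : R := 2 / (1 - 2 `^ (1 - p)).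

Lemma powR2_lt1 (R : realType) (p : R) : 1 < p -> 2 `^ (1 - p) < 1 :> R.
Proof.
move=> p1; rewrite -[1 - p]opprB powRN invf_lt1 ?powR_gt0//.
have e1 : 1 `^ (p - 1) = 1 :> R by rewrite powR1.
by rewrite -[ltLHS]e1 gt0_ltr_powR ?nnegrE ?subr_gt0 ?ltr1n.
Qed.

Lemma sewing_cst_gt0 (R : realType) (p : R) : 1 < p -> 0 < sewing_cst p.
Proof. by move=> p1; rewrite divr_gt0// subr_gt0 powR2_lt1. Qed.

(** Induction on the number of points: the interval of the partition that
straddles the midpoint leaves a partition on each side, of length at most
(b - a) / 2. As p > 1, the two halved errors add up to a fraction of the error
allowed for [a, b], and the two defects of additivity fit in the rest. *)
Lemma riemann_sum_near_germ (R : realType) (T K p : R) (Xi : R -> R -> R) :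
  1 < p -> 0 <= K -> almost_additive T K p Xi ->
  forall (a b : R) (s : seq R), 0 <= a -> b <= T -> itv_partition a b s ->
    `|riemann_sum Xi a s - Xi a b| <= sewing_cst p * K * (b - a) `^ p.
Proof.
move=> p1 K0 hXi a b s.
have p0 : p != 0 by rewrite gt_eqF// (lt_trans _ p1).
have [n] := ubnP (size s); elim: n => // n ih in a b s * => + a0 bT abs.
have ab : a <= b by exact: itv_partition_le abs.
case: s abs => [/itv_partition_nil <- _|y s'].
  have := hXi a a a a0 (lexx a) (lexx a) (le_trans ab bT).
  rewrite riemann_sum_nil !subrr !sub0r !normrN powR0// !mulr0.
  by move=> /le_trans; apply.
set s := y :: s' => abs sn.
have {}ab : a < b by apply: itv_partition_size_neq0 abs.
have [pth /eqP lst] := abs.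
have [||s1 [x [s2 [es l1 l2]]]] := @split_at_threshold _ a ((a + b) / 2) s.
- lra.
- rewrite lst; lra.
set c := last a s1 in l1.
have abs1 : itv_partition a c s1.
  by split => //; move: pth; rewrite es cat_path => /andP[].
have abs2 : itv_partition x b s2.
  move: pth lst; rewrite es cat_path last_cat /= => /andP[_ /andP[_ px]] lx.
  by split => //; exact/eqP.
have cx : c < x by move: pth; rewrite es cat_path /= => /andP[_ /andP[]].
have ac : a <= c := itv_partition_le abs1.
have xb : x <= b := itv_partition_le abs2.
have sz : (size s1 + size s2 < n)%N.
  by move: sn; rewrite es size_cat /= addnS ltnS.
have := ih a c s1 (leq_ltn_trans (leq_addr _ _) sz) a0 _ abs1.
move=> /(_ ltac:(lra)) h1.
have := ih x b s2 (leq_ltn_trans (leq_addl _ _) sz) _ bT abs2.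
move=> /(_ ltac:(lra)) h2.
have h3 := hXi a c b a0 ac (ltW (lt_le_trans cx xb)) bT.
have h4 := hXi c x b (le_trans a0 ac) (ltW cx) xb bT.
set D := (b - a) `^ p in h3 *.
have half u : 0 <= u <= (b - a) / 2 -> u `^ p <= D * 2 `^ (1 - p) / 2.
  move=> /andP[u0 u1]; apply: (@le_trans _ _ (((b - a) / 2) `^ p)).
    by rewrite ge0_ler_powR ?nnegrE//; lra.
  rewrite powRM ?subr_ge0 ?(ltW ab)// ?invr_ge0// -/D -mulrA ler_wpM2l ?powR_ge0//.
  rewrite powRD ?pnatr_eq0 ?implybT// powRr1// mulrAC mulfV ?mul1r// powRN.
  by rewrite -powR_inv1// -powRrM mulrC powRrM powR_inv1// powR_ge0.
have hc : (c - a) `^ p <= D * 2 `^ (1 - p) / 2 by apply: half; lra.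
have hx : (b - x) `^ p <= D * 2 `^ (1 - p) / 2 by apply: half; lra.
have hb : (b - c) `^ p <= D by rewrite ge0_ler_powR ?nnegrE//; lra.
rewrite es riemann_sum_cat riemann_sum_cons -/c.
set S1 := riemann_sum _ a s1 in h1 *; set S2 := riemann_sum _ x s2 in h2 *.
have -> : S1 + (Xi c x + S2) - Xi a b = (S1 - Xi a c) + (S2 - Xi x b)
  - (Xi a b - Xi a c - Xi c b) - (Xi c b - Xi c x - Xi x b) by ring.
have C0 := sewing_cst_gt0 p1.
have hC : sewing_cst p * (1 - 2 `^ (1 - p)) = 2.
  by rewrite /sewing_cst mulfVK// gt_eqF// subr_gt0 powR2_lt1.
set C := sewing_cst p in h1 h2 C0 hC *; set z := 2 `^ (1 - p) in hc hx hC.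
have CK : 0 <= C * K by rewrite mulr_ge0// ltW.
have h1' := le_trans h1 (ler_wpM2l CK hc).
have h2' := le_trans h2 (ler_wpM2l CK hx).
have h4' := le_trans h4 (ler_wpM2l K0 hb).
apply: (le_trans (ler_normB _ _)).
apply: (le_trans (lerD (ler_normB _ _) h4')).
apply: (le_trans (lerD (lerD (ler_normD _ _) h3) (lexx _))).
apply: (le_trans (lerD (lerD (lerD h1' h2') (lexx _)) (lexx _))).
rewrite le_eqVlt; apply/orP; left; apply/eqP.
have -> : C * K * D = C * (1 - z) * (K * D) + C * z * (K * D) by ring.
by rewrite hC; field.
Qed.

(** * The sewing lemma *)

Lemma fmap_ultra (T U : Type) (f : T -> U) (F : set_system T) :
  UltraFilter F -> UltraFilter (f @ F).
Proof.
move=> FU; have FP : ProperFilter F := @ultra_proper _ _ _.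
split; first exact: fmap_proper_filter.
move=> G GP sFG; rewrite eqEsubset; split => // A GA.
case: (in_ultra_setVsetC (f @^-1` A) FU) => // FA.
have /sFG GA' : (f @ F) (~` A) by [].
have : G (A `&` ~` A) by exact: filterI.
rewrite setICr => G0.
by case: (@filter_not_empty _ G GP G0).
Qed.

(** Restricting one finite set F to all intervals at once makes the sums over
adjacent intervals add up exactly. Including b and excluding a
follows the encoding of partitions, in which the left endpoint is not listed. *)
Definition nodes (R : realType) (F : seq R) (a b : R) : seq R :=
  [seq x <- sort <=%O (undup F) | a < x <= b].

Lemma nodes_sorted (R : realType) (F : seq R) (a b : R) :
  sorted <%R (nodes F a b).
Proof. by rewrite /nodes lt_sorted_filter// sort_lt_sorted undup_uniq. Qed.

Lemma mem_nodes (R : realType) (F : seq R) (a b x : R) :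
  x \in nodes F a b = (a < x <= b) && (x \in F).
Proof. by rewrite mem_filter mem_sort mem_undup. Qed.

Lemma nodes_xx (R : realType) (F : seq R) (a : R) : nodes F a a = [::].
Proof.
apply/eqP; rewrite -size_eq0 -all_pred0; apply/allP => x.
by rewrite mem_nodes; case: (ltrgtP a x).
Qed.

Lemma nodes_partition (R : realType) (F : seq R) (a b : R) :
  a <= b -> b \in F -> itv_partition a b (nodes F a b).
Proof.
move=> ab bF; split.
  rewrite (path_sortedE lt_trans) nodes_sorted andbT.
  by apply/allP => x; rewrite mem_nodes => /andP[/andP[]].
move: ab; rewrite le_eqVlt => /predU1P[->|ab]; first by rewrite nodes_xx.
have bn : b \in nodes F a b by rewrite mem_nodes ab lexx.
have srt := nodes_sorted F a b.
have : all (<= b) (nodes F a b).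
  by apply/allP => x; rewrite mem_nodes => /andP[/andP[]].
case: (lastP (nodes F a b)) bn srt => // s x.
rewrite last_rcons mem_rcons inE => /predU1P[->//|bs].
rewrite -cats1 => + /allP/(_ x); rewrite mem_cat mem_head orbT => + /(_ isT) xb.
rewrite (sorted_pairwise lt_trans) pairwise_cat => /andP[/allrelP/(_ b x bs)].
by rewrite mem_head => /(_ isT) bx; move: (lt_le_trans bx xb); rewrite ltxx.
Qed.

Lemma nodes_cat (R : realType) (F : seq R) (a b c : R) :
  a <= c -> c <= b -> nodes F a b = nodes F a c ++ nodes F c b.
Proof.
move=> ac cb; apply: lt_sorted_eq; first exact: nodes_sorted.
  rewrite (sorted_pairwise lt_trans) pairwise_cat.
  rewrite -!(sorted_pairwise lt_trans) !nodes_sorted !andbT.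
  apply/allrelP => x y; rewrite !mem_nodes => /andP[/andP[_ xc] _].
  by move=> /andP[/andP[cy _] _]; exact: le_lt_trans cy.
move=> x; rewrite mem_cat !mem_nodes -andb_orl; congr (_ && _).
case: (lerP x c) => xc /=; first by rewrite andbT orbF (le_trans xc cb) andbT.
by rewrite andbF/= (le_lt_trans ac xc).
Qed.

(** J integrates the germ Xi: when p > 1, the errors over a fine partition add up
to almost nothing, so the increments of J are limits of Riemann sums of Xi. *)
Definition sews (R : realType) (T C p : R) (Xi J : R -> R -> R) : Prop :=
  (forall s u t : R, 0 <= s -> s <= u -> u <= t -> t <= T ->
     J s t = J s u + J u t) /\
  (forall s t : R, 0 <= s -> s <= t -> t <= T ->
     `|J s t - Xi s t| <= C * (t - s) `^ p).

(** J is the limit of the sums over the nodes of F along an ultrafilter of finite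
sets F ordered by inclusion. Boundedness of these sums is all that is needed
for the limit to exist, additivity holds as soon as F contains the middle
point, and closeness to Xi passes to the limit. *)
Theorem sewing (R : realType) (T K p : R) (Xi : R -> R -> R) :
  1 < p -> 0 <= K -> almost_additive T K p Xi ->
  exists J : R -> R -> R, sews T (sewing_cst p * K) p Xi J.
Proof.
move=> p1 K0 hXi.
pose B0 : set_system (seq R) :=
  filter_from setT (fun F : seq R => [set G : seq R | {subset F <= G}]).
have B0P : ProperFilter B0.
  apply: filter_from_proper; last by move=> F _; exists F.
  apply: filter_from_filter; first by exists [::].
  move=> F1 F2 _ _; exists (F1 ++ F2) => // G sG.
  by split => x xF; apply: sG; rewrite mem_cat xF ?orbT.
have [U [UU sU]] := ultraFilterLemma B0P.
have UP : ProperFilter U := @ultra_proper _ _ _.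
pose S s t (G : seq R) := riemann_sum Xi s (nodes G s t).
have nearU t : \forall G \near U, t \in G.
  by apply: sU; exists [:: t] => // G /= sG; apply: sG; rewrite mem_head.
have bnd s t : 0 <= s -> s <= t -> t <= T ->
    \forall G \near U, `|S s t G - Xi s t| <= sewing_cst p * K * (t - s) `^ p.
  move=> s0 st tT; apply: filterS (nearU t) => G tG.
  by apply: (riemann_sum_near_germ p1 K0 hXi) => //; exact: nodes_partition.
have cv s t : 0 <= s -> s <= t -> t <= T -> cvg (S s t @ U).
  move=> s0 st tT; set M := sewing_cst p * K * (t - s) `^ p.
  have := @segment_compact R (Xi s t - M) (Xi s t + M); rewrite compact_ultra.
  move=> /(_ _ (fmap_ultra (S s t) UU)) []; last first.
    by move=> l [_ Sl]; apply/cvg_ex; exists l.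
  apply: filterS (bnd s t s0 st tT) => G; rewrite ler_norml /= in_itv /=.
  by move=> /andP[h1 h2]; apply/andP; split; rewrite -/M in h1 h2; lra.
exists (fun s t => lim (S s t @ U)); split => [s u t s0 su ut tT|s t s0 st tT].
  have c1 := cv s u s0 su (le_trans ut tT).
  have c2 := cv u t (le_trans s0 su) ut tT.
  apply: cvg_lim => //; apply: cvg_trans (cvgD c1 c2).
  apply: near_eq_cvg; apply: filterS (nearU u) => G uG.
  rewrite /S /= (nodes_cat _ su ut) riemann_sum_cat.
  by have [_ /eqP ->] := nodes_partition su uG.
have := cv s t s0 st tT; set M := _ * (t - s) `^ p.
set J := lim _ => cvJ.
have cvJ' : `|S s t G - Xi s t| @[G --> U] --> `|J - Xi s t|.
  by apply: cvg_norm; apply: cvgB => //; exact: cvg_cst.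
rewrite -(cvg_lim _ cvJ')//; apply: limr_le; first by apply/cvg_ex; eexists; exact: cvJ'.
exact: bnd.
Qed.

(** Each interval contributes an error C (v - u)^p <= C e^(p-1) (v - u); as J is
additive, the errors are the only difference and their sum telescopes. *)
Lemma riemann_sum_additive (R : realType) (T C p e : R) (Xi J : R -> R -> R) :
  1 < p -> 0 <= C -> 0 <= e ->
  sews T C p Xi J ->
  forall (a b : R) (s : seq R), 0 <= a -> b <= T -> itv_partition a b s ->
    mesh a s <= e -> `|J a b - riemann_sum Xi a s| <= C * e `^ (p - 1) * (b - a).
Proof.
move=> p1 C0 e0 [hadd hJ] a b s; elim: s a => [|x s ih] a a0 bT abs.
  have ab := itv_partition_nil abs; rewrite -ab in bT *.
  have := hadd a a a a0 (lexx a) (lexx a) bT.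
  rewrite riemann_sum_nil subrr mulr0 subr0 => /eqP.
  by rewrite -subr_eq subrr => /eqP <- _; rewrite normr0.
rewrite mesh_cons ge_max => /andP[xae me].
have xbs := itv_partition_cons abs.
have [/= /andP[ax _] _] := abs.
have xb := itv_partition_le xbs.
have x0 : 0 <= x by rewrite (le_trans a0)// ltW.
have h1 := ih x x0 bT xbs me.
have h2 := hJ a x a0 (ltW ax) (le_trans xb bT).
have h3 : (x - a) `^ p <= e `^ (p - 1) * (x - a).
  rewrite -mulr_powRB1 ?subr_ge0 ?(ltW ax)//; last exact: lt_trans p1.
  rewrite [leLHS]mulrC; apply: ler_wpM2r; first by rewrite subr_ge0 ltW.
  by rewrite ge0_ler_powR ?nnegrE// ?subr_ge0 ltW.
have h4 := ler_wpM2l C0 h3.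
rewrite riemann_sum_cons (hadd a x b a0 (ltW ax) xb bT).
have -> : J a x + J x b - (Xi a x + riemann_sum Xi x s) =
  (J a x - Xi a x) + (J x b - riemann_sum Xi x s) by ring.
apply: (le_trans (ler_normD _ _)); apply: (le_trans (lerD (le_trans h2 h4) h1)).
by rewrite mulrA -mulrDr [x - a + _]addrC subrKA.
Qed.

(** * Limits along the mesh *)

Lemma fine_partition (R : realType) (e a b : R) : 0 < e -> a <= b ->
  exists s, itv_partition a b s /\ mesh a s < e.
Proof.
move=> e0 ab.
have [n] : exists n, (b - a) < n%:R * (e / 2).
  exists (Num.bound ((b - a) / (e / 2))).
  rewrite -ltr_pdivrMr ?divr_gt0//.
  by apply: le_lt_trans (archi_boundP _); rewrite ?ler_norm// ?divr_ge0 ?subr_ge0// ltW.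
elim: n a ab => [|n ih] a ab; first by rewrite mul0r subr_lt0 ltNge ab.
move=> hn; case: (lerP (b - a) (e / 2)) => bae.
  move: ab; rewrite le_eqVlt => /predU1P[->|ab].
    by exists [::]; rewrite /mesh big_nil.
  exists [:: b]; split; first exact: itv_partition1.
  by rewrite mesh_cons /mesh big_nil gt_max e0 andbT; lra.
have [||s [hs ms]] := ih (a + e / 2).
- lra.
- move: hn; rewrite -natr1 mulrDl mul1r; lra.
exists (a + e / 2 :: s); split.
  by case: hs => h1 h2; split => //=; rewrite h1 andbT; lra.
by rewrite mesh_cons gt_max ms andbT; lra.
Qed.

Lemma mesh_filter_proper (R : realType) (a b : R) : a <= b ->
  ProperFilter (mesh_filter a b).
Proof.
move=> ab; apply: filter_from_proper.
  apply: filter_from_filter; first by exists 1 => /=.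
  move=> i j /= i0 j0; exists (Num.min i j) => /=; first by rewrite lt_min i0.
  by move=> s /= [hs]; rewrite lt_min => /andP[].
by move=> e e0; exact: fine_partition.
Qed.

Lemma riemann_sum_lim (R : realType) (T C p : R) (Xi J : R -> R -> R) :
  1 < p -> 0 <= C ->
  sews T C p Xi J ->
  forall a b : R, 0 <= a -> a <= b -> b <= T ->
    lim (riemann_sum Xi a @ mesh_filter a b) = J a b.
Proof.
move=> p1 C0 hJ a b a0 ab bT.
have FP := mesh_filter_proper ab.
apply: cvg_lim => //; apply/cvgrPdist_le => eps eps0.
set D := C * (b - a) + 1.
have D0 : 0 < D by rewrite ltr_wpDl// mulr_ge0// subr_ge0.
have p10 : p - 1 != 0 by rewrite gt_eqF// subr_gt0.
pose e := (eps / D) `^ (p - 1)^-1.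
exists e => /=; first by rewrite powR_gt0// divr_gt0.
move=> s /= [abs me].
have := riemann_sum_additive p1 C0 (powR_ge0 _ _) hJ a0 bT abs (ltW me).
move=> /le_trans; apply.
rewrite /e -powRrM mulVf// powRr1; last by rewrite divr_ge0// ltW.
have -> : C * (eps / D) * (b - a) = C * (b - a) * eps / D by ring.
by rewrite ler_pdivrMr// [leRHS]mulrC ler_wpM2r ?(ltW eps0)// /D lerDl.
Qed.

(** * Powers, and optimisation over the scale *)

(** On a bounded interval a larger exponent may be traded for a smaller one; as
long as they differ by at most 1, the factor 1 + T is uniform in both. *)
Lemma powR_weaken (R : realType) (T h a b : R) :
  0 <= h -> h <= T -> 0 < b -> b <= a -> a <= b + 1 ->
  h `^ a <= (1 + T) * h `^ b.
Proof.
move=> h0 hT b0 ba ab.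
have -> : a = (a - b) + b by rewrite subrK.
rewrite powRD; last by apply/implyP; rewrite subrK gt_eqF// (lt_le_trans b0).
rewrite ler_wpM2r ?powR_ge0//; apply: (@le_trans _ _ ((1 + T) `^ (a - b))).
  by rewrite ge0_ler_powR ?nnegrE//; lra.
by rewrite ler1_powR//; lra.
Qed.

Lemma powR_le1 (R : realType) (x a : R) : 0 <= x <= 1 -> 0 <= a -> x `^ a <= 1.
Proof.
move=> /andP[x0 x1] a0; have e1 : 1 `^ a = 1 :> R by rewrite powR1.
by rewrite -[leRHS]e1 ge0_ler_powR ?nnegrE.
Qed.

(** The optimal scale is e = z^(1/(1+k)), which balances z / e and e^k. It is
available when z <= e0^(1+k); otherwise z is bounded below and the a priori
bound x <= K is already of the required form. For z = 0 the scale tends to 0. *)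
Lemma interpolation (R : realType) (e0 k K z x : R) :
  0 < e0 <= 1 -> 0 < k -> 0 <= K -> 0 <= z -> x <= K ->
  (forall e, 0 < e <= e0 -> x <= K * (z / e + e `^ k)) ->
  x <= 2 * e0 `^ (- k) * K * (Num.min z 1) `^ (k / (1 + k)).
Proof.
move=> /andP[e00 e01] k0 K0 z0 xK hx.
have k1 : 0 < 1 + k by lra.
have s0 : 0 < k / (1 + k) by rewrite divr_gt0.
have k1n : 1 + k != 0 by rewrite gt_eqF.
have e0k : 1 <= e0 `^ (- k).
  by rewrite powRN invf_ge1 ?powR_gt0// powR_le1 ?(ltW e00)// ltW.
have e0kk : e0 `^ (- k) * e0 `^ k = 1.
  by rewrite -powRD addNr ?powRr0// eqxx gt_eqF.
case: (lerP (e0 `^ (1 + k)) z) => [hz|zlt].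
  have h1 : e0 `^ k <= Num.min z 1 `^ (k / (1 + k)).
    have -> : e0 `^ k = (e0 `^ (1 + k)) `^ (k / (1 + k)).
      by rewrite -powRrM mulrC mulfVK.
    rewrite ge0_ler_powR ?nnegrE ?powR_ge0 ?(ltW s0)//.
      by rewrite le_min z0 ler01.
    by rewrite le_min hz /= powR_le1 ?(ltW e00)// ltW.
  apply: (le_trans xK); rewrite mulrAC -[leLHS]mul1r.
  apply: ler_wpM2r => //.
  have := ler_wpM2l (powR_ge0 e0 (- k)) h1; rewrite e0kk => h2.
  by rewrite -mulrA; lra.
have z1 : z <= 1.
  by apply: (le_trans (ltW zlt)); rewrite powR_le1 ?(ltW e00)// ltW.
rewrite (min_l z1).
case: (ltrgtP z 0) z0 => // [zpos _|zz _].
  (* the balanced scale, at which z / e = e^k *)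
  pose e := z `^ (1 + k)^-1.
  have epos : 0 < e by rewrite powR_gt0.
  have ee0 : e <= e0.
    have -> : e0 = (e0 `^ (1 + k)) `^ (1 + k)^-1.
      by rewrite -powRrM mulfV// powRr1// ltW.
    by rewrite ge0_ler_powR ?nnegrE ?powR_ge0 ?invr_ge0 ?(ltW k1) ?(ltW zpos) ?(ltW zlt).
  have ek : e `^ k = z `^ (k / (1 + k)) by rewrite -powRrM mulrC.
  have ze : z / e = z `^ (k / (1 + k)).
    have -> : k / (1 + k) = 1 - (1 + k)^-1 by field.
    rewrite powRB ?powRr1 ?(ltW zpos)//.
    by rewrite (gt_eqF zpos) implybT.
  have := hx e; rewrite epos ee0 ze ek => /(_ isT) /le_trans; apply.
  have := ler_wpM2r (mulr_ge0 K0 (powR_ge0 z (k / (1 + k)))) e0k.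
  by rewrite mul1r; lra.
rewrite zz powR0 ?gt_eqF// mulr0 leNgt; apply/negP => x0.
have Kpos : 0 < K by exact: lt_le_trans xK.
pose e := Num.min e0 ((x / (2 * K)) `^ k^-1).
have xK2 : 0 < x / (2 * K) by rewrite divr_gt0// mulr_gt0.
have epos : 0 < e by rewrite lt_min e00 powR_gt0.
have := hx e; rewrite epos ge_min lexx zz mul0r add0r => /(_ isT) h.
have : e `^ k <= x / (2 * K).
  have e1 : ((x / (2 * K)) `^ k^-1) `^ k = x / (2 * K).
    by rewrite -powRrM mulVf ?gt_eqF// powRr1// ltW.
  rewrite -[leRHS]e1.
  by rewrite ge0_ler_powR ?nnegrE ?powR_ge0 ?(ltW k0) ?(ltW epos)// ge_min lexx orbT.
move=> /(ler_wpM2l K0); have -> : K * (x / (2 * K)) = x / 2.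
  by field; rewrite gt_eqF.
by lra.
Qed.

(** Bounds of the form C P z^t, where P is a power of the norm, are stable under
taking powers s <= 1, since C P >= 1. *)
Lemma small_power (R : realType) (C P z s t y : R) :
  1 <= C -> 1 <= P -> 0 <= s <= 1 -> 0 <= y ->
  y <= C * P * z `^ t -> y `^ s <= C * P * z `^ (t * s).
Proof.
move=> C1 P1 /andP[s0 s1] y0 hy.
have CP1 : 1 <= C * P by rewrite -[1]mulr1 ler_pM.
have CP0 : 0 <= C * P by exact: le_trans CP1.
apply: (@le_trans _ _ ((C * P * z `^ t) `^ s)).
  by rewrite ge0_ler_powR ?nnegrE// mulr_ge0 ?powR_ge0.
rewrite powRM ?powR_ge0// powRrM ler_wpM2r ?powR_ge0//.
exact: ler1_powR.
Qed.

(** * The Euclidean norm and roughness *)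

Lemma enorm_ge0 (R : realType) (p q : nat) (M : 'M[R]_(p, q)) : 0 <= enorm M.
Proof. exact: sqrtr_ge0. Qed.

Lemma entry_le_enorm (R : realType) (p q : nat) (M : 'M[R]_(p, q)) i j :
  `|M i j| <= enorm M.
Proof.
rewrite -sqrtr_sqr ler_wsqrtr// (bigD1 i)//= (bigD1 j)//= -addrA lerDl.
by rewrite addr_ge0// ?sumr_ge0// => *; rewrite ?sqr_ge0// sumr_ge0// => *; exact: sqr_ge0.
Qed.

Lemma enorm_le (R : realType) (p q : nat) (M : 'M[R]_(p, q)) (K : R) :
  (forall i j, `|M i j| <= K) -> enorm M <= (p * q)%:R * K.
Proof.
move=> hM.
case: (posnP (p * q)) => [/eqP|pq0].
  rewrite muln_eq0 => pq0; rewrite /enorm big1 ?sqrtr0.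
    by rewrite (eqP (_ : (p * q)%N == 0%N)) ?muln_eq0// mul0r.
  move=> i _; rewrite big1// => j _.
  by case/orP: pq0 => /eqP /eq_leq h0;
    [have := leq_trans (ltn_ord i) h0|have := leq_trans (ltn_ord j) h0].
have K0 : 0 <= K.
  move: pq0; rewrite muln_gt0 => /andP[p0 q0].
  exact: le_trans (normr_ge0 _) (hM (Ordinal p0) (Ordinal q0)).
rewrite -[leRHS]ger0_norm ?mulr_ge0// -sqrtr_sqr ler_wsqrtr//.
apply: (@le_trans _ _ (\sum_(i < p) \sum_(j < q) K ^+ 2)).
  apply: ler_sum => i _; apply: ler_sum => j _.
  by rewrite -real_normK ?num_real// lerXn2r ?nnegrE// hM.
rewrite !sumr_const !card_ord -mulrnA -[leLHS]mulr_natl mulnC exprMn.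
rewrite ler_wpM2r ?sqr_ge0// expr2 -[leLHS]mulr1 ler_wpM2l//.
by rewrite ler1n.
Qed.

Lemma enormZ (R : realType) (p q : nat) (c : R) (M : 'M[R]_(p, q)) :
  enorm (c *: M) = `|c| * enorm M.
Proof.
rewrite /enorm -sqrtr_sqr -sqrtrM ?sqr_ge0//; congr Num.sqrt.
rewrite mulr_sumr; apply: eq_bigr => i _; rewrite mulr_sumr; apply: eq_bigr => j _.
by rewrite mxE exprMn.
Qed.

(** Roughness applied in the direction of phi, for phi of arbitrary length. *)
Lemma rough_lower_bound (R : realType) (n : nat) (T theta : R)
    (X : R -> 'cV[R]_n) (L s e D K g : R) (phi : 'cV[R]_n) :
  rough_with T theta X L -> s \in `[0, T] -> 0 < e <= T / 2 ->
  0 <= K -> 0 <= D -> 0 <= g ->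
  (forall t, t \in `[0, T] ->
     `|\sum_i phi i 0 * increment X s t i 0| <= D + K * `|t - s| `^ g) ->
  enorm phi * (L * e `^ theta) <= D + K * e `^ g.
Proof.
move=> rX sT he K0 D0 g0 hphi.
have DK : 0 <= D + K * e `^ g by rewrite addr_ge0// mulr_ge0 ?powR_ge0.
have := enorm_ge0 phi; rewrite le_eqVlt => /predU1P[<-|pp]; first by rewrite mul0r.
have pn : enorm ((enorm phi)^-1 *: phi) = 1.
  by rewrite enormZ ger0_norm ?invr_ge0 ?enorm_ge0// mulVf// gt_eqF.
have [t [tT tse]] := rX s e _ sT he pn.
have -> : \sum_i ((enorm phi)^-1 *: phi) i 0 * increment X s t i 0 =
    (enorm phi)^-1 * \sum_i phi i 0 * increment X s t i 0.
  by rewrite mulr_sumr; apply: eq_bigr => i _; rewrite mxE mulrA.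
rewrite normrM ger0_norm ?invr_ge0 ?enorm_ge0// ltr_pdivlMl//.
move=> /ltW /le_trans; apply; apply: (le_trans (hphi t tT)).
rewrite lerD2l ler_wpM2l// ge0_ler_powR ?nnegrE//.
by case/andP: he => /ltW.
Qed.

(** * One row of a controlled integrand *)

Lemma norm_sum_le (R : realType) (n : nat) (f : 'I_n -> R) (c : R) :
  (forall j, `|f j| <= c) -> `|\sum_j f j| <= n%:R * c.
Proof.
move=> hf; apply: (le_trans (ler_norm_sum _ _ _)).
apply: (le_trans (ler_sum _ (fun j _ => hf j))).
by rewrite sumr_const card_ord mulr_natl.
Qed.

Lemma norm_mul_le (R : realType) (x y p q : R) :
  `|x| <= p -> `|y| <= q -> `|x * y| <= p * q.
Proof. by move=> xp yq; rewrite normrM ler_pM. Qed.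

Lemma powR_mono (R : realType) (x y a : R) : 0 <= a -> 0 <= x -> x <= y ->
  x `^ a <= y `^ a.
Proof.
by move=> a0 x0 xy; rewrite ge0_ler_powR ?nnegrE// (le_trans x0).
Qed.

Lemma powR_expn_le (R : realType) (T h a : R) (k : nat) :
  0 <= h -> h <= T -> 0 <= a <= k%:R -> h `^ a <= (1 + T) ^+ k.
Proof.
move=> h0 hT /andP[a0 ak]; apply: (@le_trans _ _ ((1 + T) `^ a)).
  by rewrite powR_mono//; lra.
by rewrite -powR_mulrn ?ler_powR//; lra.
Qed.

Lemma increment_entry (R : realType) (p q : nat) (f : R -> 'M[R]_(p, q)) s t i j :
  increment f s t i j = f t i j - f s i j.
Proof. by rewrite !mxE. Qed.

(** The bounds carried by the norms, for the i-th row of the integrand: a is the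
row A^i and a' its Gubinelli derivative, with (a' s) j k the coefficient of
A^(ij) along X^k. Entrywise bounds suffice, and a common rho bounds all of
them. *)
Record row_data (R : realType) (n : nat) (T gamma rho : R)
    (X : R -> 'cV[R]_n) (XX : R -> R -> 'M[R]_n)
    (a : R -> 'cV[R]_n) (a' : R -> 'M[R]_n) : Prop := RowData {
  row_path : forall (s t : R) i, s \in `[0, T] -> t \in `[0, T] ->
    `|increment X s t i 0| <= rho * `|t - s| `^ gamma;
  row_area : forall (s t : R) i j, s \in `[0, T] -> t \in `[0, T] ->
    `|XX s t i j| <= rho * `|t - s| `^ (2 * gamma);
  row_chen : forall (s u t : R) i j, s \in `[0, T] -> u \in `[0, T] -> t \in `[0, T] ->
    XX s t i j - XX u t i j - XX s u i j =
    increment X s u i 0 * increment X u t j 0;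
  row_start : forall i, `|a 0 i 0| <= rho;
  row_deriv : forall (s : R) i j, s \in `[0, T] -> `|a' s i j| <= rho;
  row_deriv_holder : forall (s t : R) i j, s \in `[0, T] -> t \in `[0, T] ->
    `|increment a' s t i j| <= rho * `|t - s| `^ gamma;
  row_remainder : forall (s t : R) i, s \in `[0, T] -> t \in `[0, T] ->
    `|increment a s t i 0 - \sum_k a' s i k * increment X s t k 0|
      <= rho * `|t - s| `^ (2 * gamma) }.

Definition germ (R : realType) (n : nat) (X : R -> 'cV[R]_n)
    (XX : R -> R -> 'M[R]_n) (a : R -> 'cV[R]_n) (a' : R -> 'M[R]_n) (u v : R) : R :=
  \sum_j (a u j 0 * increment X u v j 0 + \sum_k a' u j k * XX u v k j).

Lemma itv_le_dist (R : realType) (T s t : R) :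
  s \in `[0, T] -> t \in `[0, T] -> `|t - s| <= T.
Proof. by rewrite !in_itv /= ler_norml => /andP[? ?] /andP[? ?]; lra. Qed.

Lemma row_holder (R : realType) (n : nat) (T gamma rho : R) X XX a a' :
  3^-1 < gamma <= 2^-1 -> 0 < T -> 1 <= rho -> @row_data R n T gamma rho X XX a a' ->
  forall s t i, s \in `[0, T] -> t \in `[0, T] ->
    `|increment a s t i 0| <= (n%:R + 1 + T) * rho ^+ 2 * `|t - s| `^ gamma.
Proof.
move=> hg T0 r1 rd s t i sT tT.
have h0 := normr_ge0 (t - s); have hT := itv_le_dist sT tT.
set h := `|t - s| in h0 hT *.
have h1 := row_remainder rd i sT tT; rewrite -/h in h1.
have h2 : `|\sum_k a' s i k * increment X s t k 0| <= n%:R * (rho * (rho * h `^ gamma)).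
  by apply: norm_sum_le => k; apply: norm_mul_le; [exact: (row_deriv rd)|exact: (row_path rd)].
have h3 : h `^ (2 * gamma) <= (1 + T) * h `^ gamma by apply: powR_weaken; lra.
have r0 : 0 <= rho by lra.
have h4 := ler_wpM2l r0 h3.
set S := \sum_k _ in h1 h2.
rewrite -[increment _ _ _ _ _](subrK S); apply: (le_trans (ler_normD _ _)).
apply: (le_trans (lerD (le_trans h1 h4) h2)).
have p0 := powR_ge0 h gamma; set p := h `^ gamma in p0 *.
have T1 : 0 <= (1 + T) * p by rewrite mulr_ge0//; lra.
have := ler_wpM2l T1 (ler_wpM2r r0 r1); nra.
Qed.

(** The norm sees the size of A at time 0 only; elsewhere this size is
recovered from A' and the remainder, at the price of a second factor rho. *)
Lemma row_bounded (R : realType) (n : nat) (T gamma : R) :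
  3^-1 < gamma <= 2^-1 -> 0 < T ->
  exists2 C : R, 1 <= C & forall rho X XX a a', 1 <= rho ->
    @row_data R n T gamma rho X XX a a' ->
    forall s i, s \in `[0, T] -> `|a s i 0| <= C * rho ^+ 2.
Proof.
move=> hg T0; have N0 : 0 <= n%:R :> R by exact: ler0n.
have c0 : 0 <= (n%:R + 1 + T) * (1 + T) :> R by rewrite mulr_ge0//; lra.
exists (1 + (n%:R + 1 + T) * (1 + T)) => [|rho X XX a a' r1 rd s i sT]; first lra.
have z0 : 0 \in `[0, T] by rewrite in_itv /= lexx ltW.
have := row_holder hg T0 r1 rd i z0 sT.
rewrite increment_entry subr0 [`|s|]ger0_norm; last by move: sT; rewrite in_itv /= => /andP[].
have hs : s `^ gamma <= (1 + T) ^+ 1.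
  by move: sT; rewrite in_itv /= => /andP[s0 s1]; apply: powR_expn_le => //; lra.
have := row_start rd i.
set a0 := a 0 i 0; set as_ := a s i 0 => h1 h2.
rewrite -[as_](subrK a0); apply: (le_trans (ler_normD _ _)).
apply: (le_trans (lerD h2 h1)).
have c1 : 0 <= (n%:R + 1 + T) * rho ^+ 2 by rewrite mulr_ge0 ?sqr_ge0//; lra.
have := ler_wpM2l c1 hs; rewrite expr1.
have := ler_wpM2l (le_trans ler01 r1) r1; rewrite mulr1; nra.
Qed.

(** By Chen's relation the defect of additivity over s <= u <= t is
- R_(su) dX_(ut) - (a'_u - a'_s) XX_(ut), of order 2 gamma + gamma. *)
Lemma germ_almost_additive (R : realType) (n : nat) (T gamma rho : R) X XX a a' :
  0 < gamma -> 0 <= rho -> @row_data R n T gamma rho X XX a a' ->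
  almost_additive T (n%:R * (1 + n%:R) * rho ^+ 2) (3 * gamma) (germ X XX a a').
Proof.
move=> g0 r0 rd s u t s0 su ut tT.
have sI : s \in `[0, T] by rewrite in_itv /= s0; lra.
have uI : u \in `[0, T] by rewrite in_itv /=; lra.
have tI : t \in `[0, T] by rewrite in_itv /= tT andbT; lra.
rewrite /germ -!sumrB -!mulrA; apply: norm_sum_le => j.
have -> : a s j 0 * increment X s t j 0 + \sum_k a' s j k * XX s t k j -
    (a s j 0 * increment X s u j 0 + \sum_k a' s j k * XX s u k j) -
    (a u j 0 * increment X u t j 0 + \sum_k a' u j k * XX u t k j) =
  - ((increment a s u j 0 - \sum_k a' s j k * increment X s u k 0) * increment X u t j 0)
  - \sum_k increment a' s u j k * XX u t k j.
  have e1 : \sum_k a' s j k * XX s t k j - \sum_k a' s j k * XX s u k j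
      - \sum_k a' u j k * XX u t k j =
      (\sum_k a' s j k * increment X s u k 0) * increment X u t j 0
      - \sum_k increment a' s u j k * XX u t k j.
    rewrite mulr_suml -!sumrB; apply: eq_bigr => k _.
    have -> : XX s t k j = increment X s u k 0 * increment X u t j 0
        + XX s u k j + XX u t k j by rewrite -(row_chen rd)//; ring.
    by rewrite [increment a' _ _ _ _]increment_entry; ring.
  move: e1; set S1 := \sum_k _; set S2 := \sum_k _; set S3 := \sum_k _.
  set S4 := \sum_k _; set S5 := \sum_k _ => e1.
  have -> : S1 = (S4 * increment X u t j 0 - S5) + S2 + S3 by rewrite -e1; ring.
  by rewrite !increment_entry; ring.
have d1 : 0 <= u - s <= t - s by lra.
have d2 : 0 <= t - u <= t - s by lra.
case/andP: d1 => d10 d11; case/andP: d2 => d20 d21.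
set h := t - s in d11 d21 *.
have h0 : 0 <= h by lra.
have hh : h `^ (2 * gamma) * h `^ gamma = h `^ (3 * gamma).
  have -> : 3 * gamma = 2 * gamma + gamma by ring.
  by rewrite powRD//; apply/implyP; lra.
have g2 : 0 <= 2 * gamma by lra.
have b1 := row_remainder rd j sI uI; have b2 := row_path rd j uI tI.
rewrite [`|u - s|]ger0_norm// in b1; rewrite [`|t - u|]ger0_norm// in b2.
have b1' := le_trans b1 (ler_wpM2l r0 (powR_mono g2 d10 d11)).
have b2' := le_trans b2 (ler_wpM2l r0 (powR_mono (ltW g0) d20 d21)).
have b3 : `|\sum_k increment a' s u j k * XX u t k j| <=
    n%:R * ((rho * h `^ gamma) * (rho * h `^ (2 * gamma))).
  apply: norm_sum_le => k; apply: norm_mul_le.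
    have := row_deriv_holder rd j k sI uI; rewrite [`|u - s|]ger0_norm// => /le_trans; apply.
    by rewrite ler_wpM2l// powR_mono// ltW.
  have := row_area rd k j uI tI; rewrite [`|t - u|]ger0_norm// => /le_trans; apply.
  by rewrite ler_wpM2l// powR_mono.
apply: (le_trans (ler_normB _ _)); rewrite normrN.
apply: (le_trans (lerD (norm_mul_le b1' b2') b3)).
by rewrite -hh le_eqVlt; apply/orP; left; apply/eqP; ring.
Qed.

Lemma row_integral (R : realType) (n : nat) (T gamma : R) :
  3^-1 < gamma <= 2^-1 ->
  exists2 C : R, 1 <= C & forall rho X XX a a', 1 <= rho ->
    @row_data R n T gamma rho X XX a a' ->
    exists J, sews T (C * rho ^+ 2) (3 * gamma) (germ X XX a a') J /\
      forall t, 0 <= t -> t <= T ->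
        lim (riemann_sum (germ X XX a a') 0 @ mesh_filter 0 t) = J 0 t.
Proof.
move=> hg; have g3 : 1 < 3 * gamma by lra.
have N0 : 0 <= n%:R * (1 + n%:R) :> R by rewrite mulr_ge0// addr_ge0.
have S0 := sewing_cst_gt0 g3.
have SN0 := mulr_ge0 (ltW S0) N0.
exists (1 + sewing_cst (3 * gamma) * (n%:R * (1 + n%:R))) => [|rho X XX a a' r1 rd].
  by rewrite lerDl.
have r0 : 0 <= rho by lra.
have g0 : 0 < gamma by lra.
have hXi := germ_almost_additive g0 r0 rd.
have K0 : 0 <= n%:R * (1 + n%:R) * rho ^+ 2 :> R by rewrite mulr_ge0 ?sqr_ge0.
have [J [hadd hJ]] := sewing g3 K0 hXi.
set C := 1 + _; have C0 : 0 <= C * rho ^+ 2.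
  by rewrite mulr_ge0 ?sqr_ge0// addr_ge0.
have sJ : sews T (C * rho ^+ 2) (3 * gamma) (germ X XX a a') J.
  split=> // s t s0 st tT; apply: (le_trans (hJ s t s0 st tT)).
  rewrite ler_wpM2r ?powR_ge0// mulrA ler_wpM2r ?sqr_ge0//.
  by rewrite /C lerDr.
exists J; split => // t t0 tT; exact: (riemann_sum_lim g3 C0 sJ).
Qed.

(** * Smallness of the integrand and of its derivative *)

(** The only term of order less than 2 gamma in an increment of Z is the pairing
of a_s with the increment of X; solving for it leaves two values of Z and
terms of order h^(2 gamma). *)
Lemma pairing_bound (R : realType) (n : nat) (T gamma C1 : R) :
  3^-1 < gamma <= 2^-1 -> 0 < T -> 1 <= C1 ->
  exists2 C : R, 1 <= C & forall rho X XX a a' J (Ib : R -> R) z, 1 <= rho ->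
    @row_data R n T gamma rho X XX a a' ->
    sews T (C1 * rho ^+ 2) (3 * gamma) (germ X XX a a') J ->
    (forall s t, 0 <= s -> s <= t -> t <= T -> `|Ib t - Ib s| <= rho * (t - s)) ->
    (forall t, t \in `[0, T] -> `|J 0 t + Ib t| <= z) ->
    forall s t, s \in `[0, T] -> t \in `[0, T] ->
      `|\sum_j a s j 0 * increment X s t j 0|
        <= 2 * z + C * rho ^+ 3 * `|t - s| `^ (2 * gamma).
Proof.
move=> hg T0 C1p; set N : R := n%:R; have N0 : 0 <= N by exact: ler0n.
pose C := (N * N + C1 * (1 + T) + (1 + T)) + N * (N + 1 + T).
have T0' := ltW T0; have C10 : 0 <= C1 by lra.
have C0 : 0 <= C by rewrite !(addr_ge0, mulr_ge0).
exists (1 + C) => [|rho X XX a a' J Ib z r1 rd [hadd hJ] hIb hz]; first lra.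
have r0 : 0 <= rho by lra.
(* forward in time, the pairing is read off from the increments of J + Ib *)
have fwd u v : 0 <= u -> u <= v -> v <= T ->
    `|\sum_j a u j 0 * increment X u v j 0| <=
    2 * z + (N * N + C1 * (1 + T) + (1 + T)) * rho ^+ 2 * (v - u) `^ (2 * gamma).
  move=> u0 uv vT.
  have uI : u \in `[0, T] by rewrite in_itv /= u0; lra.
  have vI : v \in `[0, T] by rewrite in_itv /= vT andbT; lra.
  have h0 : 0 <= v - u by lra.
  have hT : v - u <= T by lra.
  have b1 := hJ u v u0 uv vT; have b2 := hIb u v u0 uv vT.
  have b3 := hz u uI; have b4 := hz v vI.
  have b5 : `|\sum_j \sum_k a' u j k * XX u v k j| <=
      N * (N * (rho * (rho * (v - u) `^ (2 * gamma)))).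
    apply: norm_sum_le => j; apply: norm_sum_le => k.
    apply: norm_mul_le; first exact: (row_deriv rd).
    by have := row_area rd k j uI vI; rewrite [`|v - u|]ger0_norm.
  have e1 : J 0 v = J 0 u + J u v by exact: hadd.
  have e2 : germ X XX a a' u v = \sum_j a u j 0 * increment X u v j 0 +
      \sum_j \sum_k a' u j k * XX u v k j by rewrite /germ big_split.
  have w1 : (v - u) `^ (3 * gamma) <= (1 + T) * (v - u) `^ (2 * gamma).
    by apply: powR_weaken; lra.
  have w2 : v - u <= (1 + T) * (v - u) `^ (2 * gamma).
    by rewrite -{1}[v - u]powRr1//; apply: powR_weaken; lra.
  move: b1 b2 b3 b4 b5; rewrite e2 e1.
  set S1 := \sum_j a u j 0 * _; set S2 := \sum_j \sum_k _.
  set p2 := (v - u) `^ (2 * gamma) in w1 w2 *.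
  set p3 := (v - u) `^ (3 * gamma) in w1 *.
  move=> b1 b2 b3 b4 b5.
  have p20 : 0 <= p2 by exact: powR_ge0.
  have -> : S1 = (J 0 u + J u v + Ib v) - (J 0 u + Ib u) - (Ib v - Ib u)
     - (J u v - (S1 + S2)) - S2 by ring.
  apply: (le_trans (ler_normB _ _)); apply: (le_trans (lerD (ler_normB _ _) b5)).
  apply: (le_trans (lerD (lerD (ler_normB _ _) b1) (lexx _))).
  apply: (le_trans (lerD (lerD (lerD (ler_normB _ _) b2) (lexx _)) (lexx _))).
  apply: (le_trans (lerD (lerD (lerD (lerD b4 b3) (lexx _)) (lexx _)) (lexx _))).
  have w1' : C1 * rho ^+ 2 * p3 <= C1 * rho ^+ 2 * ((1 + T) * p2).
    by rewrite ler_wpM2l// mulr_ge0 ?sqr_ge0//; lra.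
  have w2' : rho * (v - u) <= rho ^+ 2 * ((1 + T) * p2).
    rewrite ler_pM//; first by rewrite expr2 ler_peMl.
  have -> : (N * N + C1 * (1 + T) + (1 + T)) * rho ^+ 2 * p2 =
    N * (N * (rho * (rho * p2))) + C1 * rho ^+ 2 * ((1 + T) * p2)
    + rho ^+ 2 * ((1 + T) * p2) by ring.
  by lra.
have r23 : rho ^+ 2 <= rho ^+ 3 by rewrite ler_weXn2l.
have c10 : 0 <= N * N + C1 * (1 + T) + (1 + T).
  by rewrite !(addr_ge0, mulr_ge0).
have c20 : 0 <= N * (N + 1 + T) by rewrite !(addr_ge0, mulr_ge0).
move=> s t sI tI; have := sI; have := tI; rewrite !in_itv /=.
move=> /andP[t0 tT] /andP[s0 sT].
set p := `|t - s| `^ (2 * gamma).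
have p0 : 0 <= p by exact: powR_ge0.
have r3p : 0 <= rho ^+ 3 * p by rewrite mulr_ge0// exprn_ge0.
have key : (N * N + C1 * (1 + T) + (1 + T)) * rho ^+ 2 * p <=
    (N * N + C1 * (1 + T) + (1 + T)) * rho ^+ 3 * p.
  by rewrite ler_wpM2r// ler_wpM2l.
have c20p : 0 <= N * (N + 1 + T) * rho ^+ 3 * p.
  by rewrite -mulrA mulr_ge0.
have eC : (1 + C) * rho ^+ 3 * p = rho ^+ 3 * p +
  ((N * N + C1 * (1 + T) + (1 + T)) * rho ^+ 3 * p + N * (N + 1 + T) * rho ^+ 3 * p).
  by rewrite /C; ring.
case: (lerP s t) => st.
  have ets : t - s = `|t - s| by rewrite ger0_norm// subr_ge0.
  have := fwd s t s0 st tT; rewrite ets -/p.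
  by move=> /le_trans; apply; rewrite eC; lra.
(* backwards, the coefficient is moved from s to t *)
have := fwd t s t0 (ltW st) sT.
have -> : s - t = `|t - s| by rewrite distrC gtr0_norm// subr_gt0.
rewrite -/p => b1.
have b2 : `|\sum_j increment a s t j 0 * increment X s t j 0| <=
    N * (((N + 1 + T) * rho ^+ 2 * `|t - s| `^ gamma) * (rho * `|t - s| `^ gamma)).
  apply: norm_sum_le => j; apply: norm_mul_le; last exact: (row_path rd).
  exact: (row_holder hg T0 r1 rd).
have pp : `|t - s| `^ gamma * `|t - s| `^ gamma = p.
  rewrite -powRD; last by apply/implyP; lra.
  by congr (_ `^ _); ring.
have -> : \sum_j a s j 0 * increment X s t j 0 =
    - (\sum_j a t j 0 * increment X t s j 0)
    - \sum_j increment a s t j 0 * increment X s t j 0.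
  rewrite -sumrN -sumrB; apply: eq_bigr => j _; rewrite !increment_entry; ring.
apply: (le_trans (ler_normB _ _)); rewrite normrN.
apply: (le_trans (lerD b1 b2)).
have -> : N * ((N + 1 + T) * rho ^+ 2 * `|t - s| `^ gamma * (rho * `|t - s| `^ gamma)) =
  N * (N + 1 + T) * rho ^+ 3 * p by rewrite -pp; ring.
by rewrite eC; lra.
Qed.

(** A vector whose pairings with the increments of X are at most
2 D + K h^(2 gamma) has size C (D h^(-theta) + h^(2 gamma - theta)), since X
moves by L h^theta in its direction; interpolation then applies, and the a
priori bound on phi takes care of D that is not small. *)
Lemma rough_smallness (R : realType) (n : nat) (T gamma theta k : R)
    (X : R -> 'cV[R]_n) (L rho s D K : R) (phi : 'cV[R]_n) :
  0 < T -> 0 < theta < 1 -> 0 < k -> k <= 2 * gamma - theta ->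
  rough_with T theta X L -> 0 < L -> L^-1 <= 2 * rho ->
  s \in `[0, T] -> 1 <= K -> 0 <= D -> enorm phi <= 4 * rho * K ->
  (forall t, t \in `[0, T] ->
     `|\sum_i phi i 0 * increment X s t i 0|
       <= 2 * D + K * `|t - s| `^ (2 * gamma)) ->
  enorm phi <= 8 * Num.min 1 (T / 2) `^ (- k) * (rho * K) * Num.min D 1 `^ (k / (1 + k)).
Proof.
move=> T0 /andP[th0 th1] k0 kg rX L0 Lr sT K1 D0 cap hphi.
have r0 : 0 < rho by have := invr_gt0 L; rewrite L0 => h; lra.
have K0 : 0 <= K by lra.
have rK : 0 <= 4 * rho * K by rewrite !mulr_ge0// ltW.
have e0 : 0 < Num.min 1 (T / 2) <= 1 by rewrite lt_min ge_min ltr01 lexx /= divr_gt0.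
have := interpolation e0 k0 rK D0 cap.
have -> : 2 * Num.min 1 (T / 2) `^ (- k) * (4 * rho * K) =
  8 * Num.min 1 (T / 2) `^ (- k) * (rho * K) by ring.
apply=> e /andP[ep]; rewrite le_min => /andP[e1 eT].
have h := @rough_lower_bound _ _ _ _ _ _ _ e (2 * D) K (2 * gamma) phi rX sT _ K0 _ _ hphi.
have {}h : enorm phi * (L * e `^ theta) <= 2 * D + K * e `^ (2 * gamma).
  by apply: h; rewrite ?ep//; lra.
have eth : 0 < e `^ theta by rewrite powR_gt0.
have Le : 0 < L * e `^ theta by rewrite mulr_gt0.
rewrite -ler_pdivlMr// in h; apply: (le_trans h).
rewrite invfM mulrCA.
have g1 : (2 * D + K * e `^ (2 * gamma)) / e `^ theta <= 2 * K * (D / e + e `^ k).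
  rewrite mulrDl.
  have a1 : 2 * D / e `^ theta <= 2 * K * (D / e).
    apply: (@le_trans _ _ (2 * D / e)).
      rewrite ler_wpM2l ?mulr_ge0// lef_pV2 ?posrE//.
      by rewrite -{1}[e]powRr1 ?(ltW ep)// ger_powR ?ep// ltW.
    by rewrite -[2 * K * _]mulrA -mulrA ler_wpM2l// ler_peMl// divr_ge0// ltW.
  have a2 : K * e `^ (2 * gamma) / e `^ theta <= K * e `^ k.
    rewrite -mulrA ler_wpM2l// -powRB; last by rewrite (gt_eqF ep) implybT.
    by rewrite ger_powR// ep.
  have a3 : 0 <= K * e `^ k by rewrite mulr_ge0 ?powR_ge0.
  by lra.
have g2 : 0 <= 2 * K * (D / e + e `^ k).
  by rewrite !mulr_ge0// addr_ge0 ?powR_ge0// divr_ge0// ltW.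
have Li0 : 0 <= L^-1 by rewrite invr_ge0 ltW.
apply: (le_trans (ler_wpM2l Li0 g1)); apply: (le_trans (ler_wpM2r g2 Lr)).
by rewrite le_eqVlt; apply/orP; left; apply/eqP; ring.
Qed.

Lemma row_small (R : realType) (n : nat) (T gamma theta k C1 : R) :
  3^-1 < gamma <= 2^-1 -> 0 < theta < 1 -> 0 < T -> 1 <= C1 ->
  0 < k -> k <= 2 * gamma - theta ->
  exists2 C : R, 1 <= C & forall rho X XX a a' J (Ib : R -> R) z L, 1 <= rho ->
    @row_data R n T gamma rho X XX a a' ->
    sews T (C1 * rho ^+ 2) (3 * gamma) (germ X XX a a') J ->
    (forall s t, 0 <= s -> s <= t -> t <= T -> `|Ib t - Ib s| <= rho * (t - s)) ->
    0 <= z -> (forall t, t \in `[0, T] -> `|J 0 t + Ib t| <= z) ->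
    rough_with T theta X L -> 0 < L -> L^-1 <= 2 * rho ->
    forall s i, s \in `[0, T] ->
      `|a s i 0| <= C * rho ^+ 4 * Num.min z 1 `^ (k / (1 + k)).
Proof.
move=> hg hth T0 C1p k0 kg.
have [C2 C2p hC2] := row_bounded n hg T0.
have [C3 C3p hC3] := pairing_bound n hg T0 C1p.
set N : R := n%:R; have N0 : 0 <= N by exact: ler0n.
pose E := 8 * Num.min 1 (T / 2) `^ (- k).
have E0 : 0 <= E by rewrite mulr_ge0 ?powR_ge0.
have C20 : 0 <= C2 by lra.
have C30 : 0 <= C3 by lra.
have EC : 0 <= E * (C3 + N * C2) by rewrite mulr_ge0// addr_ge0// mulr_ge0.
exists (1 + E * (C3 + N * C2)); first by rewrite lerDl.
move=> rho X XX a a' J Ib z L r1 rd sJ hIb z0 hz rX L0 Lr s i sT.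
have r0 : 0 <= rho by lra.
have r21 : 1 <= rho ^+ 2 by rewrite exprn_ege1.
have r31 : 1 <= rho ^+ 3 by rewrite exprn_ege1.
(* K dominates both the error of the pairing and the a priori size of a *)
pose K := (C3 + N * C2) * rho ^+ 3.
have K1 : 1 <= K.
  by rewrite -[1]mulr1 /K ler_pM// -[1]addr0 lerD// mulr_ge0.
have cap : enorm (a s) <= 4 * rho * K.
  apply: (@le_trans _ _ (N * (C2 * rho ^+ 2))).
    rewrite /N -{2}[n]muln1; apply: enorm_le => x j; rewrite ord1; exact: hC2 rd _ _ _.
  have h1 : N * (C2 * rho ^+ 2) <= N * C2 * rho ^+ 3.
    by rewrite mulrA ler_wpM2l ?mulr_ge0// ler_weXn2l.
  have h2 : N * C2 * rho ^+ 3 <= K.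
    by rewrite /K ler_wpM2r ?exprn_ge0// lerDr; lra.
  have h3 : K <= rho * K by rewrite ler_peMl//; lra.
  lra.
have := rough_smallness T0 hth k0 kg rX L0 Lr sT K1 z0 cap.
have pb t : t \in `[0, T] -> `|\sum_i a s i 0 * increment X s t i 0| <=
    2 * z + K * `|t - s| `^ (2 * gamma).
  move=> tT; apply: (le_trans (hC3 _ _ _ _ _ _ _ _ r1 rd sJ hIb hz s t sT tT)).
  by rewrite lerD2l ler_wpM2r ?powR_ge0// /K ler_wpM2r ?exprn_ge0// lerDl mulr_ge0.
move=> /(_ pb) /(le_trans (entry_le_enorm _ i 0)) /le_trans; apply.
rewrite ler_wpM2r ?powR_ge0// -/E /K.
have -> : E * (rho * ((C3 + N * C2) * rho ^+ 3)) = E * (C3 + N * C2) * rho ^+ 4 by ring.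
by rewrite ler_wpM2r ?exprn_ge0// lerDr.
Qed.

(** The j-th row of a' pairs with the increments of X to give those of a_j, up to
the remainder: roughness makes a' small as soon as a is. *)
Lemma deriv_small (R : realType) (n : nat) (T gamma theta k : R) :
  3^-1 < gamma <= 2^-1 -> 0 < theta < 1 -> 0 < T ->
  0 < k -> k <= 2 * gamma - theta ->
  exists2 C : R, 1 <= C & forall rho X XX a a' A L, 1 <= rho ->
    @row_data R n T gamma rho X XX a a' ->
    0 <= A -> (forall s i, s \in `[0, T] -> `|a s i 0| <= A) ->
    rough_with T theta X L -> 0 < L -> L^-1 <= 2 * rho ->
    forall s i j, s \in `[0, T] ->
      `|a' s i j| <= C * rho ^+ 2 * Num.min A 1 `^ (k / (1 + k)).
Proof.
move=> hg hth T0 k0 kg.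
set N : R := n%:R; have N0 : 0 <= N by exact: ler0n.
pose E := 8 * Num.min 1 (T / 2) `^ (- k).
have E0 : 0 <= E by rewrite mulr_ge0 ?powR_ge0.
have EC : 0 <= E * (1 + N) by rewrite mulr_ge0// addr_ge0.
exists (1 + E * (1 + N)) => [|rho X XX a a' A L r1 rd A0 hA rX L0 Lr s i j sT].
  by rewrite lerDl.
have r0 : 0 <= rho by lra.
pose K := (1 + N) * rho.
have K1 : 1 <= K by rewrite -[1]mulr1 /K ler_pM// lerDl.
pose phi : 'cV[R]_n := \col_k a' s i k.
have cap : enorm phi <= 4 * rho * K.
  apply: (@le_trans _ _ (N * rho)).
    rewrite /N -{2}[n]muln1; apply: enorm_le => x y; rewrite mxE; exact: (row_deriv rd).
  have h1 : N * rho <= K by rewrite /K ler_wpM2r// lerDr.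
  have h2 : K <= rho * K by rewrite ler_peMl//; lra.
  lra.
have pb t : t \in `[0, T] -> `|\sum_i phi i 0 * increment X s t i 0| <=
    2 * A + K * `|t - s| `^ (2 * gamma).
  move=> tT; have b1 := row_remainder rd i sT tT.
  have b2 := hA s i sT; have b3 := hA t i tT.
  have -> : \sum_i phi i 0 * increment X s t i 0 =
      a t i 0 - a s i 0
      - (increment a s t i 0 - \sum_k a' s i k * increment X s t k 0).
    rewrite [increment a _ _ _ _]increment_entry opprB addrC subrK.
    by apply: eq_bigr => y _; rewrite mxE.
  apply: (le_trans (ler_normB _ _)).
  apply: (le_trans (lerD (ler_normB _ _) b1)).
  have h : rho * `|t - s| `^ (2 * gamma) <= K * `|t - s| `^ (2 * gamma).
    by rewrite ler_wpM2r ?powR_ge0// /K ler_peMl// lerDl.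
  lra.
have := rough_smallness T0 hth k0 kg rX L0 Lr sT K1 A0 cap pb.
have := entry_le_enorm phi j 0; rewrite mxE => /le_trans h /h /le_trans; apply.
rewrite ler_wpM2r ?powR_ge0// -/E /K.
have -> : E * (rho * ((1 + N) * rho)) = E * (1 + N) * rho ^+ 2 by ring.
by rewrite ler_wpM2r ?exprn_ge0// lerDr.
Qed.

(** * Smallness of the rough integral and of the drift *)

(** The interval is covered by at most 2 / e steps of length e T. On each of them
the germ is at most a multiple of A, with an error of order e^(3 gamma). *)
Lemma integral_scale_bound (R : realType) (n : nat) (T gamma k C1 : R) :
  3^-1 < gamma <= 2^-1 -> 0 < T -> 1 <= C1 -> 0 < k -> k <= 3 * gamma - 1 ->
  exists2 C : R, 1 <= C & forall rho X XX a a' J A e, 1 <= rho ->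
    @row_data R n T gamma rho X XX a a' ->
    sews T (C1 * rho ^+ 2) (3 * gamma) (germ X XX a a') J ->
    0 <= A -> (forall s i, s \in `[0, T] -> `|a s i 0| <= A) ->
    (forall s i j, s \in `[0, T] -> `|a' s i j| <= A) ->
    0 < e <= 1 -> forall t, t \in `[0, T] ->
      `|J 0 t| <= C * rho ^+ 2 * (A / e + e `^ k).
Proof.
move=> hg T0 C1p k0 kg.
have T0' := ltW T0; have C10 : 0 <= C1 by lra.
set N : R := n%:R; have N0 : 0 <= N by exact: ler0n.
pose G := N * (1 + N) * (1 + T).
have G0 : 0 <= G by rewrite !(mulr_ge0, addr_ge0).
have H0 : 0 <= C1 * (1 + T) ^+ 2 by rewrite !(mulr_ge0, addr_ge0, exprn_ge0).
exists (1 + 2 * (G + C1 * (1 + T) ^+ 2)).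
  by rewrite lerDl mulr_ge0// addr_ge0.
move=> rho X XX a a' J A e r1 rd [hadd hJ] A0 hA hA' he t tT.
have r0 : 0 <= rho by lra.
case/andP: he => ep e1.
have g3 : 0 <= 3 * gamma by lra.
have r2 : 0 <= rho ^+ 2 by exact: exprn_ge0.
pose h := e * T.
have h0 : 0 <= h by rewrite mulr_ge0// ltW.
have hT : h <= T by rewrite /h ler_piMl.
pose B := G * (rho * A) + C1 * rho ^+ 2 * h `^ (3 * gamma).
have B0 : 0 <= B by rewrite !(mulr_ge0, addr_ge0, powR_ge0, exprn_ge0).
have short u v : 0 <= u -> u <= v -> v <= T -> v - u <= h -> `|J u v| <= B.
  move=> u0 uv vT uvh.
  have uI : u \in `[0, T] by rewrite in_itv /= u0; lra.
  have vI : v \in `[0, T] by rewrite in_itv /= vT andbT; lra.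
  have d0 : 0 <= v - u by lra.
  have dT : v - u <= T by lra.
  have b1 := hJ u v u0 uv vT.
  have b2 : `|germ X XX a a' u v| <= N * (A * (rho * (1 + T)) + N * (A * (rho * (1 + T)))).
    apply: norm_sum_le => j; apply: (le_trans (ler_normD _ _)); apply: lerD.
      apply: norm_mul_le; first exact: hA.
      apply: (le_trans (row_path rd j uI vI)); rewrite ler_wpM2l// ger0_norm//.
      by rewrite -[1 + T]expr1; apply: powR_expn_le => //; lra.
    apply: norm_sum_le => l; apply: norm_mul_le; first exact: hA'.
    apply: (le_trans (row_area rd l j uI vI)); rewrite ler_wpM2l// ger0_norm//.
    by rewrite -[1 + T]expr1; apply: powR_expn_le => //; lra.
  rewrite -[J u v](subrK (germ X XX a a' u v)).
  apply: (le_trans (ler_normD _ _)); apply: (le_trans (lerD b1 b2)).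
  have b3 : C1 * rho ^+ 2 * (v - u) `^ (3 * gamma) <= C1 * rho ^+ 2 * h `^ (3 * gamma).
    by rewrite ler_wpM2l ?mulr_ge0// powR_mono.
  have -> : N * (A * (rho * (1 + T)) + N * (A * (rho * (1 + T)))) = G * (rho * A).
    by rewrite /G; ring.
  by rewrite /B; lra.
have long (q : nat) u v : 0 <= u -> u <= v -> v <= T -> v - u <= q%:R * h ->
    `|J u v| <= q%:R * B.
  elim: q u => [|q ih] u u0 uv vT.
    rewrite !mul0r subr_le0 => vu; have {vu uv} uv : u = v by apply/le_anti; rewrite uv.
    rewrite -uv in vT *; have := hadd u u u u0 (lexx u) (lexx u) vT => /eqP.
    by rewrite -subr_eq subrr => /eqP <-; rewrite normr0.
  rewrite -natr1 mulrDl mul1r => hq.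
  case: (lerP (v - u) h) => uvh.
    apply: (le_trans (short u v u0 uv vT uvh)).
    by rewrite mulrDl mul1r lerDr mulr_ge0.
  have uh : 0 <= u + h by lra.
  have s1 := short u (u + h) u0 ltac:(lra) ltac:(lra) ltac:(lra).
  have s2 := ih (u + h) uh ltac:(lra) vT ltac:(lra).
  rewrite (hadd u (u + h) v) //; try lra.
  apply: (le_trans (ler_normD _ _)); lra.
have := tT; rewrite in_itv /= => /andP[t0 tle].
pose q := (Num.truncn e^-1).+1.
have ei : 0 <= e^-1 by rewrite invr_ge0 ltW.
have ei1 : 1 <= e^-1 by rewrite invf_ge1.
have /andP[q1 q2] := truncn_itv ei.
rewrite -/q in q2.
have q3 : q%:R <= 2 * e^-1 by rewrite /q -natr1; lra.
have qh : t - 0 <= q%:R * h.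
  rewrite subr0; apply: (le_trans tle); rewrite /h mulrA ler_peMl//.
  by have := ltW q2; rewrite -{1}[e^-1]mul1r ler_pdivrMr.
apply: (le_trans (long q 0 t (lexx 0) t0 tle qh)).
apply: (le_trans (ler_wpM2r B0 q3)).
have eE : e^-1 * h `^ (3 * gamma) <= (1 + T) ^+ 2 * e `^ k.
  rewrite /h powRM ?(ltW ep)// mulrA mulrC.
  apply: ler_pM; rewrite ?powR_ge0 ?mulr_ge0 ?powR_ge0//.
    by apply: powR_expn_le => //; lra.
  rewrite -powR_inv1 ?(ltW ep)// -powRD; last by rewrite (gt_eqF ep) implybT.
  by rewrite ger_powR ?ep//; lra.
have f1 : rho * A <= rho ^+ 2 * A by rewrite ler_wpM2r// expr2 ler_peMl.
have f2 : G * (rho * A) <= G * (rho ^+ 2 * A) by rewrite ler_wpM2l.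
have f3 := ler_wpM2l (mulr_ge0 C10 r2) eE.
have f4 := ler_wpM2l ei f2.
have f5 : 0 <= rho ^+ 2 * (A / e + e `^ k).
  by rewrite !(mulr_ge0, addr_ge0, powR_ge0).
have f6 : 0 <= C1 * (1 + T) ^+ 2 * rho ^+ 2 * (A * e^-1).
  by apply: mulr_ge0; apply: mulr_ge0.
have f7 : 0 <= G * rho ^+ 2 * e `^ k.
  by apply: mulr_ge0; [exact: mulr_ge0|exact: powR_ge0].
rewrite /B; move: f3 f4 f5 f6 f7.
set p := h `^ _; set y := e `^ k; set x := e^-1; set w := (1 + T) ^+ 2.
by lra.
Qed.

Lemma integral_small (R : realType) (n : nat) (T gamma k C1 : R) :
  3^-1 < gamma <= 2^-1 -> 0 < T -> 1 <= C1 -> 0 < k -> k <= 3 * gamma - 1 ->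
  exists2 C : R, 1 <= C & forall rho X XX a a' J A, 1 <= rho ->
    @row_data R n T gamma rho X XX a a' ->
    sews T (C1 * rho ^+ 2) (3 * gamma) (germ X XX a a') J ->
    0 <= A -> (forall s i, s \in `[0, T] -> `|a s i 0| <= A) ->
    (forall s i j, s \in `[0, T] -> `|a' s i j| <= A) ->
    forall t, t \in `[0, T] ->
      `|J 0 t| <= C * rho ^+ 4 * Num.min A 1 `^ (k / (1 + k)).
Proof.
move=> hg T0 C1p k0 kg.
have [C2 C2p hC2] := row_bounded n hg T0.
have [C3 C3p hC3] := integral_scale_bound n hg T0 C1p k0 kg.
exists (2 * (C3 * (C2 + 2))) => [|rho X XX a a' J A r1 rd sJ A0 hA hA' t tT].
  by nra.
have r0 : 0 <= rho by lra.
have r2 : 1 <= rho ^+ 2 by exact: exprn_ege1.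
have r20 : 0 <= rho ^+ 2 by lra.
pose K := C3 * (C2 + 2) * rho ^+ 4.
have C30 : 0 <= C3 by lra.
have K0 : 0 <= K by rewrite /K !mulr_ge0 ?exprn_ge0//; lra.
have b0 : 0 <= (C2 + 1) * rho ^+ 2 by rewrite mulr_ge0//; lra.
have cap : `|J 0 t| <= K.
  have := hC3 rho X XX a a' J ((C2 + 1) * rho ^+ 2) 1 r1 rd sJ b0.
  rewrite divr1 powR1 ltr01 lexx => h; apply: (le_trans (h _ _ isT t tT)).
  - move=> s i sT; apply: (le_trans (hC2 _ _ _ _ _ r1 rd s i sT)).
    by rewrite ler_wpM2r//; lra.
  - move=> s i j sT; apply: (le_trans (row_deriv rd i j sT)).
    apply: (@le_trans _ _ (rho ^+ 2)); first by rewrite expr2 ler_peMl.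
    by rewrite ler_peMl//; lra.
  - have -> : K = C3 * rho ^+ 2 * ((C2 + 2) * rho ^+ 2) by rewrite /K; ring.
    by rewrite ler_wpM2l ?mulr_ge0//; lra.
have e0 : 0 < (1 : R) <= 1 by rewrite ltr01 lexx.
have := interpolation e0 k0 K0 A0 cap; rewrite powR1 mulr1.
have -> : 2 * K = 2 * (C3 * (C2 + 2)) * rho ^+ 4 by rewrite /K; ring.
apply=> e he.
apply: (le_trans (hC3 _ _ _ _ _ _ _ _ r1 rd sJ A0 hA hA' he t tT)).
rewrite ler_wpM2r//.
  by case/andP: he => ep _; rewrite addr_ge0 ?powR_ge0// divr_ge0// ltW.
rewrite /K -mulrA ler_wpM2l//; apply: (@le_trans _ _ (rho ^+ 4)).
  by rewrite ler_weXn2l.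
by rewrite ler_peMl ?exprn_ge0//; lra.
Qed.

(** For a continuous b, this mean value estimate characterises the antiderivatives
of b, which spares the later arguments any integration theory. *)
Definition primitive_on (R : realType) (T : R) (b Ib : R -> R) : Prop :=
  forall s t c K : R, 0 <= s -> s <= t -> t <= T ->
    (forall u : R, s <= u <= t -> `|b u - c| <= K) ->
    `|Ib t - Ib s - c * (t - s)| <= K * (t - s).

(** Over a step of length e around s, the integral of b is e b_s up to
rho e^(1 + gamma): dividing by e bounds b_s by 2 D / e + rho e^gamma. The step is
taken to the left of s when there is no room on the right. *)
Lemma drift_small (R : realType) (T gamma k : R) :
  0 < T -> 0 < gamma -> 0 < k -> k <= gamma ->
  exists2 C : R, 1 <= C & forall (rho : R) (b Ib : R -> R) (D : R), 1 <= rho ->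
    (forall s, s \in `[0, T] -> `|b s| <= rho) ->
    (forall s t, s \in `[0, T] -> t \in `[0, T] ->
       `|b t - b s| <= rho * `|t - s| `^ gamma) ->
    primitive_on T b Ib -> 0 <= D ->
    (forall s t, s \in `[0, T] -> t \in `[0, T] -> `|Ib t - Ib s| <= 2 * D) ->
    forall s, s \in `[0, T] -> `|b s| <= C * rho * Num.min D 1 `^ (k / (1 + k)).
Proof.
move=> T0 g0 k0 kg; pose E := 4 * Num.min 1 (T / 2) `^ (- k).
have E0 : 0 <= E by rewrite mulr_ge0 ?powR_ge0.
exists (1 + E) => [|rho b Ib D r1 hb hbh hI D0 hD s sT]; first by rewrite lerDl.
have r0 : 0 <= rho by lra.
have := sT; rewrite in_itv /= => /andP[s0 sle].
have e0 : 0 < Num.min 1 (T / 2) <= 1 by rewrite lt_min ge_min ltr01 lexx /= divr_gt0.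
have K0 : 0 <= 2 * rho by lra.
have cap : `|b s| <= 2 * rho by have := hb s sT; lra.
have := interpolation e0 k0 K0 D0 cap.
have -> : 2 * Num.min 1 (T / 2) `^ (- k) * (2 * rho) = E * rho by rewrite /E; ring.
move=> h; apply: (le_trans (h _)); last first.
  by rewrite ler_wpM2r ?powR_ge0// ler_wpM2r// lerDr.
move=> {h} e /andP[ep]; rewrite le_min => /andP[e1 eT].
have key u v : 0 <= u -> u <= v -> v <= T -> v - u = e -> u <= s <= v ->
    `|b s| <= 2 * rho * (D / e + e `^ k).
  move=> u0 uv vT vue us.
  have uI : u \in `[0, T] by rewrite in_itv /= u0; lra.
  have vI : v \in `[0, T] by rewrite in_itv /= vT andbT; lra.
  have b1 := hI u v (b s) (rho * e `^ gamma) u0 uv vT.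
  have {}b1 : `|Ib v - Ib u - b s * (v - u)| <= rho * e `^ gamma * (v - u).
    apply: b1 => w uw; have wI : w \in `[0, T] by rewrite in_itv /=; lra.
    apply: (le_trans (hbh s w sT wI)); rewrite ler_wpM2l// powR_mono ?(ltW g0)//.
    by rewrite -vue ler_norml; lra.
  have b2 := hD u v uI vI.
  have b3 : `|b s| * e <= 2 * D + rho * e `^ gamma * e.
    have -> : `|b s| * e = `|(Ib v - Ib u) - (Ib v - Ib u - b s * (v - u))|.
      by rewrite opprB addrC subrK normrM vue [`|e|]gtr0_norm.
    by apply: (le_trans (ler_normB _ _)); rewrite vue in b1 *; lra.
  move: b3; rewrite -ler_pdivlMr// => /le_trans; apply.
  rewrite mulrDl mulfK ?gt_eqF//.
  have b4 : e `^ gamma <= e `^ k by rewrite ger_powR// ep.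
  have b5 := ler_wpM2l r0 b4.
  have b6 : 0 <= rho * e `^ k by rewrite mulr_ge0 ?powR_ge0.
  have b7 : D / e <= rho * (D / e) by rewrite ler_peMl// divr_ge0// ltW.
  by rewrite -mulrA; lra.
case: (lerP (s + e) T) => se.
  by apply: (key s (s + e)) => //; lra.
by apply: (key (s - e) s) => //; lra.
Qed.

Lemma powR_shrink (R : realType) (y t s : R) : 0 <= y <= 1 -> 0 <= t -> 0 <= s <= 1 ->
  y `^ t <= y `^ (t * s).
Proof.
move=> y01 t0 /andP[s0 s1]; rewrite powRrM.
have := powR_ge0 y t; rewrite le_eqVlt => /predU1P[<-|yp]; first exact: powR_ge0.
by rewrite ger1_powR// yp powR_le1.
Qed.

(** The four steps in turn. Each replaces a bound C rho^p y^t, with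
y = min (z, 1), by one with exponent t s0; truncating z at 1 makes all powers
of y comparable, so that every bound can be weakened to the last one. *)
Lemma row_estimate (R : realType) (n : nat) (T gamma theta k C0 : R) :
  3^-1 < gamma <= 2^-1 -> 0 < theta < 1 -> 0 < T -> 1 <= C0 ->
  0 < k -> k <= 2 * gamma - theta -> k <= 3 * gamma - 1 -> k <= gamma ->
  let s0 := k / (1 + k) in
  exists2 C : R, 1 <= C & forall rho X XX a a' J (b Ib : R -> R) z L, 1 <= rho ->
    @row_data R n T gamma rho X XX a a' ->
    sews T (C0 * rho ^+ 2) (3 * gamma) (germ X XX a a') J ->
    (forall s, s \in `[0, T] -> `|b s| <= rho) ->
    (forall s t, s \in `[0, T] -> t \in `[0, T] ->
       `|b t - b s| <= rho * `|t - s| `^ gamma) ->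
    primitive_on T b Ib ->
    0 <= z -> (forall t, t \in `[0, T] -> `|J 0 t + Ib t| <= z) ->
    rough_with T theta X L -> 0 < L -> L^-1 <= 2 * rho ->
    forall s, s \in `[0, T] ->
      (forall i, `|a s i 0| <= C * rho ^+ 11 * z `^ (s0 * s0 * s0 * s0)) /\
      `|b s| <= C * rho ^+ 11 * z `^ (s0 * s0 * s0 * s0).
Proof.
move=> hg hth T0 C0p k0 k1 k2 k3 s0.
have g0 : 0 < gamma by lra.
have [C1 C1p hC1] := row_small n hg hth T0 C0p k0 k1.
have [C2 C2p hC2] := deriv_small n hg hth T0 k0 k1.
have [C3 C3p hC3] := integral_small n hg T0 C0p k0 k2.
have [C4 C4p hC4] := drift_small T0 g0 k0 k3.
have kk : 0 < 1 + k by lra.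
have s00 : 0 < s0 by rewrite divr_gt0.
have s01 : s0 <= 1 by rewrite ler_pdivrMr//; lra.
have s0I : 0 <= s0 <= 1 by rewrite s01 ltW.
have [C10 C20 C30] : [/\ 0 <= C1, 0 <= C2 & 0 <= C3] by split; lra.
have mul1 (x y : R) : 1 <= x -> 1 <= y -> 1 <= x * y.
  by move=> x1 y1; rewrite -[1]mulr1 ler_pM.
have C12 : 1 <= C1 * C2 by exact: mul1.
have C123 : 1 <= C3 * (C1 * C2) by exact: mul1.
have C123d : 1 <= 2 * (C3 * (C1 * C2)) by lra.
have Cp : 1 <= C4 * (2 * (C3 * (C1 * C2))) by exact: mul1.
exists (C4 * (2 * (C3 * (C1 * C2)))) => //.
move=> rho X XX a a' J b Ib z L r1 rd sJ hb hbh hI z0 hz rX L0 Lr.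
have r0 : 0 <= rho by lra.
have rn j : 1 <= rho ^+ j by rewrite exprn_ege1.
have rn0 j : 0 <= rho ^+ j by rewrite exprn_ge0.
pose y := Num.min z 1.
have y0 : 0 <= y by rewrite le_min z0 ler01.
have y01 : 0 <= y <= 1 by rewrite y0 ge_min lexx orbT.
have hIb s t : 0 <= s -> s <= t -> t <= T -> `|Ib t - Ib s| <= rho * (t - s).
  move=> t0 st tT; have := hI s t 0 rho t0 st tT; rewrite mul0r subr0; apply.
  by move=> u hu; rewrite subr0; apply: hb; rewrite in_itv /=; lra.
have ha := hC1 _ _ _ _ _ _ _ _ _ r1 rd sJ hIb z0 hz rX L0 Lr; rewrite -/s0 -/y in ha.
pose A1 := C1 * rho ^+ 4 * y `^ s0.
have A10 : 0 <= A1 by rewrite mulr_ge0 ?powR_ge0// mulr_ge0.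
have ha' := hC2 _ _ _ _ _ _ _ r1 rd A10 ha rX L0 Lr; rewrite -/s0 in ha'.
(* a common bound for a and a' *)
pose A2 := C1 * C2 * rho ^+ 6 * y `^ (s0 * s0).
have A20 : 0 <= A2 by rewrite mulr_ge0 ?powR_ge0// mulr_ge0// mulr_ge0.
have minl (x : R) : 0 <= x -> Num.min x 1 `^ s0 <= x `^ s0.
  move=> x0; apply: powR_mono; first exact: ltW.
    by rewrite le_min x0 ler01.
  by rewrite ge_min lexx.
have a2 s i : s \in `[0, T] -> `|a s i 0| <= A2.
  move=> sT; apply: (le_trans (ha s i sT)); rewrite /A2.
  apply: ler_pM; rewrite ?powR_ge0 ?mulr_ge0//; try lra.
    by apply: ler_pM => //; [rewrite ler_peMr|rewrite ler_weXn2l].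
  by apply: powR_shrink => //; exact: ltW.
have a2' s i j : s \in `[0, T] -> `|a' s i j| <= A2.
  move=> sT; apply: (le_trans (ha' s i j sT)).
  have h1 : Num.min A1 1 `^ s0 <= C1 * rho ^+ 4 * y `^ (s0 * s0).
    by apply: (le_trans (minl _ A10)); apply: small_power.
  have h2 : 0 <= C2 * rho ^+ 2 by rewrite mulr_ge0//; lra.
  apply: (le_trans (ler_wpM2l h2 h1)).
  by rewrite le_eqVlt; apply/orP; left; apply/eqP; rewrite /A2; ring.
have hJ := hC3 _ _ _ _ _ _ _ r1 rd sJ A20 a2 a2'; rewrite -/s0 in hJ.
pose I3 := C3 * (C1 * C2) * rho ^+ 10 * y `^ (s0 * s0 * s0).
have I30 : 0 <= I3 by rewrite mulr_ge0 ?powR_ge0// mulr_ge0// !mulr_ge0.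
have hJ' t : t \in `[0, T] -> `|J 0 t| <= I3.
  move=> tT; apply: (le_trans (hJ t tT)).
  have h1 : Num.min A2 1 `^ s0 <= C1 * C2 * rho ^+ 6 * y `^ (s0 * s0 * s0).
    by apply: (le_trans (minl _ A20)); apply: small_power.
  have h2 : 0 <= C3 * rho ^+ 4 by rewrite mulr_ge0//; lra.
  apply: (le_trans (ler_wpM2l h2 h1)).
  by rewrite le_eqVlt; apply/orP; left; apply/eqP; rewrite /I3; ring.
(* the integral of b is the difference of z and of the rough integral *)
have D0 : 0 <= z + I3 by rewrite addr_ge0.
have hD s t : s \in `[0, T] -> t \in `[0, T] -> `|Ib t - Ib s| <= 2 * (z + I3).
  move=> sT tT; have b1 := hz s sT; have b2 := hz t tT.
  have b3 := hJ' s sT; have b4 := hJ' t tT.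
  have -> : Ib t - Ib s = (J 0 t + Ib t) - (J 0 s + Ib s) - J 0 t + J 0 s by ring.
  apply: (le_trans (ler_normD _ _)); apply: (le_trans (lerD (ler_normB _ _) (lexx _))).
  by apply: (le_trans (lerD (lerD (ler_normB _ _) (lexx _)) (lexx _))); lra.
have hB := hC4 _ _ _ _ r1 hb hbh hI D0 hD; rewrite -/s0 in hB.
have s0' := ltW s00; have s2 := mulr_ge0 s0' s0'.
have s3 := mulr_ge0 s2 s0'; have s4 := mulr_ge0 s3 s0'.
have yz : y `^ (s0 * s0 * s0 * s0) <= z `^ (s0 * s0 * s0 * s0).
  by apply: powR_mono => //; rewrite /y ge_min lexx.
have shr : y `^ (s0 * s0) <= y `^ (s0 * s0 * s0 * s0).
  by apply: (@le_trans _ _ (y `^ (s0 * s0 * s0))); exact: powR_shrink.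
have C0' : 0 <= C4 * (2 * (C3 * (C1 * C2))) by lra.
move=> s sT; split=> [i|].
  apply: (le_trans (a2 s i sT)).
  apply: ler_pM; last exact: le_trans shr yz.
  - by rewrite !mulr_ge0.
  - exact: powR_ge0.
  apply: ler_pM; [exact: mulr_ge0|by []| |by rewrite ler_weXn2l].
  have h1 : C1 * C2 <= C3 * (C1 * C2) by rewrite ler_peMl// mulr_ge0.
  have h2 : 2 * (C3 * (C1 * C2)) <= C4 * (2 * (C3 * (C1 * C2))).
    by rewrite ler_peMl//; lra.
  by lra.
apply: (le_trans (hB s sT)).
have m1 : Num.min (z + I3) 1 <= 2 * (C3 * (C1 * C2)) * rho ^+ 10 * y `^ (s0 * s0 * s0).
  have h1 : Num.min (z + I3) 1 <= y + I3.
    rewrite /y; case: (lerP z 1) => z1; first by rewrite ge_min lexx.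
    by rewrite ge_min lerDl I30 orbT.
  have h2 : y <= I3.
    apply: (@le_trans _ _ (y `^ (s0 * s0 * s0))).
      rewrite -{1}[y]powRr1//.
      apply: (@le_trans _ _ (y `^ (1 * s0))); first exact: powR_shrink.
      rewrite mul1r; apply: (@le_trans _ _ (y `^ (s0 * s0))).
        by apply: powR_shrink => //; exact: ltW.
      exact: powR_shrink.
    rewrite /I3 ler_peMl ?powR_ge0//.
    by rewrite -[1]mulr1 ler_pM.
  apply: (le_trans h1).
  have -> : 2 * (C3 * (C1 * C2)) * rho ^+ 10 * y `^ (s0 * s0 * s0) = I3 + I3.
    by rewrite /I3; ring.
  by rewrite lerD2r.
have m0 : 0 <= Num.min (z + I3) 1 by rewrite le_min D0 ler01.
have m2 := small_power C123d (rn 10) s0I m0 m1.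
have h2 : 0 <= C4 * rho by rewrite mulr_ge0//; lra.
apply: (le_trans (ler_wpM2l h2 m2)).
have -> : C4 * rho * (2 * (C3 * (C1 * C2)) * rho ^+ 10 * y `^ (s0 * s0 * s0 * s0)) =
  C4 * (2 * (C3 * (C1 * C2))) * rho ^+ 11 * y `^ (s0 * s0 * s0 * s0) by ring.
by rewrite ler_wpM2l// mulr_ge0.
Qed.

(** * The time integral *)

Lemma holder_continuous (R : realType) (T gamma K : R) (b : R -> R) :
  0 < gamma -> 0 <= K ->
  (forall s t, s \in `[0, T] -> t \in `[0, T] ->
     `|b t - b s| <= K * `|t - s| `^ gamma) ->
  {within `[0, T], continuous b}.
Proof.
move=> g0 K0 hb; apply/subspace_continuousP => x xT.
apply/cvgrPdist_le => e e0.
have K1 : 0 < K + 1 by lra.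
have d0 : 0 < (e / (K + 1)) `^ gamma^-1 by rewrite powR_gt0// divr_gt0.
near=> t.
have tT : `[0, T]%classic t by near: t; exact: withinT.
have ht : `|x - t| <= (e / (K + 1)) `^ gamma^-1.
  near: t; apply: cvg_within; apply/nbhs_ballP.
  by exists ((e / (K + 1)) `^ gamma^-1) => // u /ltW.
apply: (le_trans (hb t x tT xT)).
have h1 : `|x - t| `^ gamma <= e / (K + 1).
  apply: (le_trans (powR_mono (ltW g0) (normr_ge0 _) ht)).
  by rewrite -powRrM mulVf ?gt_eqF// powRr1// divr_ge0// ltW.
apply: (le_trans (ler_wpM2l K0 h1)).
by rewrite mulrCA ler_piMr ?(ltW e0)// ler_pdivrMr//; lra.
Unshelve. all: by end_near. Qed.

Lemma integral_primitive (R : realType) (T : R) (b : R -> R) :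
  {within `[0, T], continuous b} ->
  primitive_on T b (fun t => \int[lebesgue_measure]_(s in `[0, t]) b s).
Proof.
move=> cb s t c K s0 st tT hK.
have ib : lebesgue_measure.-integrable `[0, t] (EFin \o b).
  apply: continuous_compact_integrable; first exact: segment_compact.
  apply: continuous_subspaceW cb => x /=; rewrite !in_itv /= => /andP[-> xt].
  exact: le_trans xt tT.
rewrite (Rintegral_itvB ib); [|by rewrite bnd_simp|by rewrite bnd_simp].
have sub : `]s, t] `<=` `[0, t].
  by move=> x /=; rewrite !in_itv /= => /andP[sx ->]; rewrite andbT (le_trans s0)// ltW.
have ib' : lebesgue_measure.-integrable `]s, t] (EFin \o b).
  exact: integrableS ib.
have mst : fine (@lebesgue_measure R `]s, t]) = t - s.
  rewrite lebesgue_measure_itv /= lte_fin; case: ltP => // ts.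
  by rewrite (@le_anti _ _ s t) ?subrr// st.
have icst (r : R) : lebesgue_measure.-integrable `]s, t] (EFin \o cst r).
  have i0 : lebesgue_measure.-integrable `[0, t] (EFin \o cst r).
    apply: continuous_compact_integrable; first exact: segment_compact.
    by apply: continuous_subspaceT => x; exact: cst_continuous.
  exact: integrableS i0.
have cE r : \int[@lebesgue_measure R]_(x in `]s, t]) r = r * (t - s).
  by rewrite Rintegral_cst// mst.
rewrite -cE -RintegralB//; last exact: icst.
have idf : lebesgue_measure.-integrable `]s, t] (EFin \o (fun x => b x - c)).
  exact: (integrableB _ ib' (icst c)).
apply: (le_trans (le_normr_Rintegral _ idf)) => //.
rewrite -cE; apply: le_Rintegral => //.
- exact: (integrable_norm idf).
- exact: icst.
- by move=> x /=; rewrite in_itv /= => /andP[/ltW sx xt]; apply: hK; rewrite sx.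
Qed.

(** * From extended norms to real bounds *)

Lemma supnorm_le (R : realType) (p q : nat) (T r : R) (f : R -> 'M[R]_(p, q)) :
  (supnorm T f <= r%:E)%E ->
  forall t i j, t \in `[0, T] -> `|f t i j| <= r.
Proof.
move=> hr t i j tT; apply: (le_trans (entry_le_enorm _ i j)).
by rewrite -lee_fin (le_trans _ hr)//; apply: ereal_sup_ubound; exists t.
Qed.

Lemma supnorm_leP (R : realType) (p q : nat) (T r : R) (f : R -> 'M[R]_(p, q)) :
  (forall t i j, t \in `[0, T] -> `|f t i j| <= r) ->
  (supnorm T f <= ((p * q)%:R * r)%:E)%E.
Proof.
move=> hf; apply: ge_ereal_sup => _ [t tT <-]; rewrite lee_fin.
by apply: enorm_le => i j; exact: hf.
Qed.

Lemma holder2_le (R : realType) (p q : nat) (T alpha r : R)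
    (F : R -> R -> 'M[R]_(p, q)) :
  0 <= r -> (holder2 T alpha F <= r%:E)%E ->
  (forall s i j, s \in `[0, T] -> F s s i j = 0) ->
  forall s t i j, s \in `[0, T] -> t \in `[0, T] ->
    `|F s t i j| <= r * `|t - s| `^ alpha.
Proof.
move=> r0 hr F0 s t i j sT tT; have [<-|st] := eqVneq s t.
  by rewrite F0// normr0 mulr_ge0 ?powR_ge0.
apply: (le_trans (entry_le_enorm _ i j)).
have d0 : 0 < `|t - s| `^ alpha.
  by rewrite powR_gt0// normr_gt0 subr_eq0 eq_sym.
rewrite -ler_pdivrMr// -lee_fin (le_trans _ hr)//; apply: ereal_sup_ubound.
by exists (s, t).
Qed.

Lemma supnorm_ge0 (R : realType) (p q : nat) (T : R) (f : R -> 'M[R]_(p, q)) :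
  0 < T -> (0 <= supnorm T f)%E.
Proof.
move=> T0; apply: (@le_trans _ _ (enorm (f 0))%:E).
  by rewrite lee_fin enorm_ge0.
by apply: ereal_sup_ubound; exists 0 => //=; rewrite in_itv /= lexx ltW.
Qed.

Lemma holder2_ge0 (R : realType) (p q : nat) (T alpha : R)
    (F : R -> R -> 'M[R]_(p, q)) :
  0 < T -> (0 <= holder2 T alpha F)%E.
Proof.
move=> T0; apply: (@le_trans _ _ (enorm (F 0 T) / `|T - 0| `^ alpha)%:E).
  by rewrite lee_fin divr_ge0 ?enorm_ge0 ?powR_ge0.
apply: ereal_sup_ubound; exists (0, T) => //=; split=> //=.
- by rewrite in_itv /= lexx ltW.
- by rewrite in_itv /= lexx ltW.
- by rewrite lt_eqF.
Qed.

Lemma ge0_real (R : realType) (x : \bar R) : (0 <= x)%E -> (x < +oo)%E ->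
  exists2 r : R, 0 <= r & x = r%:E.
Proof.
move=> x0 xoo; have xf : x \is a fin_num by rewrite ge0_fin_numE.
by exists (fine x); rewrite ?fine_ge0 ?fineK.
Qed.

(** The supremum defining the roughness need not be attained, which costs a factor
2 on the inverse, and it is infinite when n = 0, where its inverse is 0: the
term 1 covers that case. *)
Lemma roughness_constant (R : realType) (n : nat) (T theta : R) (X : R -> 'cV[R]_n) :
  holder_rough T theta X ->
  exists v : R, [/\ 0 <= v, ((roughness T theta X)^-1 = v%:E)%E &
    exists L, [/\ 0 < L, rough_with T theta X L & L^-1 <= 1 + 2 * v]].
Proof.
move=> [L0 [L0p hL0]].
have Lr : (L0%:E <= roughness T theta X)%E by apply: ereal_sup_ubound; exists L0.
have get (x : R) : 0 < x -> (x%:E < roughness T theta X)%E ->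
    exists L, [/\ 0 < L, rough_with T theta X L & L^-1 <= x^-1].
  move=> x0 /ereal_sup_gt[_ [L [Lp hL] <-]]; rewrite lte_fin => xL.
  by exists L; split=> //; rewrite lef_pV2 ?posrE// ltW.
case E : (roughness T theta X) Lr get => [r| |] Lr get; last by [].
  rewrite lee_fin in Lr; have r0 : 0 < r by exact: lt_le_trans Lr.
  exists r^-1; rewrite inver gt_eqF//; split=> //; first by rewrite invr_ge0 ltW.
  have [||L [Lp hL Lb]] := get (r / 2); first by rewrite divr_gt0.
    by rewrite lte_fin; lra.
  exists L; split=> //; apply: (le_trans Lb).
  by rewrite invfM invrK; lra.
exists 0; split=> //; have [||L [Lp hL Lb]] := get 1 => //; first by rewrite ltry.
by exists L; split=> //; move: Lb; rewrite invr1; lra.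
Qed.

(** All terms are nonnegative and finite, so their sum is a real number that
dominates each of them. *)
Lemma finite_norms (R : realType) (n k m : nat) (T gamma theta : R)
    (X : R -> 'cV[R]_n) (XX : R -> R -> 'M[R]_n)
    (Y : R -> 'cV[R]_k) (Y' : R -> 'M[R]_(k, n)) (B : R -> 'cV[R]_m) :
  0 < T -> rough_path T gamma X XX -> holder_rough T theta X ->
  controlled T gamma X Y Y' -> (holder_norm T gamma B < +oo)%E ->
  exists rho : R, 1 <= rho /\
    (1 + (roughness T theta X)^-1 + rough_path_norm T gamma X XX
       + controlled_norm T gamma X Y Y' + holder_norm T gamma B = rho%:E)%E /\
    (exists L, [/\ 0 < L, rough_with T theta X L & L^-1 <= 2 * rho]) /\
    [/\ (holder T gamma X <= rho%:E)%E, (holder2 T (2 * gamma) XX <= rho%:E)%E &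
        enorm (Y 0) <= rho] /\
    [/\ (supnorm T Y' <= rho%:E)%E, (holder T gamma Y' <= rho%:E)%E &
        (holder2 T (2 * gamma) (remainder X Y Y') <= rho%:E)%E] /\
    (supnorm T B <= rho%:E)%E /\ (holder T gamma B <= rho%:E)%E.
Proof.
move=> T0 [_ _ _ Xoo] /roughness_constant[v [v0 vE [L [L0 hL Lv]]]] [_ Y'oo remoo] Boo.
rewrite /controlled_norm vE; move: Xoo Y'oo remoo Boo.
rewrite /rough_path_norm /holder_norm.
have h1 := holder2_ge0 gamma (increment X) T0.
have h2 := holder2_ge0 (2 * gamma) XX T0.
have h3 := supnorm_ge0 Y' T0.
have h4 := holder2_ge0 gamma (increment Y') T0.
have h5 := holder2_ge0 (2 * gamma) (remainder X Y Y') T0.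
have h6 := supnorm_ge0 B T0.
have h7 := holder2_ge0 gamma (increment B) T0.
move: h1 h2 h3 h4 h5 h6 h7; rewrite -!/(holder _ _ _).
have ltyD (x y : \bar R) : (0 <= x)%E -> (0 <= y)%E -> (x + y < +oo)%E ->
    (x < +oo)%E /\ (y < +oo)%E.
  move=> x0 y0 xy; split; apply: le_lt_trans xy; first by rewrite leeDl.
  by rewrite leeDr.
move=> h1 h2 h3 h4 h5 h6 h7.
move=> /(ltyD _ _ h1 h2)[f1 f2] /(ltyD _ _ h3 h4)[f3 f4] f5 /(ltyD _ _ h6 h7)[f6 f7].
have [r1 p1 ->] := ge0_real h1 f1.
have [r2 p2 ->] := ge0_real h2 f2.
have [r3 p3 ->] := ge0_real h3 f3.
have [r4 p4 ->] := ge0_real h4 f4.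
have [r5 p5 ->] := ge0_real h5 f5.
have [r6 p6 ->] := ge0_real h6 f6.
have [r7 p7 ->] := ge0_real h7 f7.
have p8 := enorm_ge0 (Y 0).
exists (1 + v + (r1 + r2) + (enorm (Y 0) + (r3 + r4) + r5) + (r6 + r7)).
rewrite !lee_fin !EFinD; split; first lra.
split=> //; split; first by exists L; split=> //; lra.
by do ![split]; lra.
Qed.

Lemma row_data_of_norms (R : realType) (m n : nat) (T gamma rho : R)
    (X : R -> 'cV[R]_n) (XX : R -> R -> 'M[R]_n)
    (A : R -> 'M[R]_(m, n)) (A' : R -> 'M[R]_(m * n, n)) (i : 'I_m) :
  0 < T -> 1 <= rho -> rough_path T gamma X XX ->
  [/\ (holder T gamma X <= rho%:E)%E, (holder2 T (2 * gamma) XX <= rho%:E)%E &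
      enorm (flatten_path A 0) <= rho] ->
  [/\ (supnorm T A' <= rho%:E)%E, (holder T gamma A' <= rho%:E)%E &
      (holder2 T (2 * gamma) (remainder X (flatten_path A) A') <= rho%:E)%E] ->
  row_data T gamma rho X XX (fun s => (row i (A s))^T)
    (fun s => \matrix_(j, l) A' s (mxvec_index i j) l).
Proof.
move=> T0 r1 [_ _ chen _] [hX hXX hA0] [sA' hA' hrem].
have r0 : 0 <= rho by lra.
have inc0 p q (f : R -> 'M[R]_(p, q)) s x y : increment f s s x y = 0.
  by rewrite increment_entry subrr.
have fE s j : flatten_path A s (mxvec_index i j) 0 = A s i j by rewrite !mxE mxvecE.
split.
- by move=> s t j sT tT; apply: (holder2_le r0 hX).
- move=> s t j l sT tT; apply: (holder2_le r0 hXX) => // u x y uT.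
  have := chen u u u uT uT uT x y; rewrite !inc0 mul0r => /eqP.
  by rewrite subrr sub0r oppr_eq0 => /eqP.
- by move=> s u t j l sT uT tT; exact: chen.
- move=> j; rewrite !mxE -fE; exact: le_trans (entry_le_enorm _ _ _) hA0.
- by move=> s j l sT; rewrite mxE; exact: (supnorm_le sA').
- move=> s t j l sT tT.
  have A'0 u x y : u \in `[0, T] -> increment A' u u x y = 0 by [].
  have := holder2_le r0 hA' A'0 (mxvec_index i j) l sT tT.
  by rewrite !increment_entry !mxE.
- move=> s t j sT tT.
  have rem0 u x y : u \in `[0, T] -> remainder X (flatten_path A) A' u u x y = 0.
    move=> _; rewrite /remainder mxE inc0 !mxE big1 ?subr0 ?oppr0 ?addr0//.
    by move=> l _; rewrite inc0 mulr0.
  have := holder2_le r0 hrem rem0 (mxvec_index i j) 0 sT tT.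
  rewrite /remainder [X in `|X|]mxE [X in _ + X]mxE [X in _ - X]mxE.
  rewrite !increment_entry !fE !mxE.
  by under [X in _ -> `|_ - X| <= _]eq_bigr => l _ do rewrite mxE.
Qed.

Lemma rough_integral_row (R : realType) (m n : nat) (X : R -> 'cV[R]_n)
    (XX : R -> R -> 'M[R]_n) (A : R -> 'M[R]_(m, n)) (A' : R -> 'M[R]_(m * n, n))
    (t : R) (i : 'I_m) :
  rough_integral X XX A A' t i 0 =
  lim (riemann_sum (germ X XX (fun s => (row i (A s))^T)
    (fun s => \matrix_(j, l) A' s (mxvec_index i j) l)) 0 @ mesh_filter 0 t).
Proof.
rewrite mxE; set f := (F in lim (F @ _)); set g := riemann_sum _ _.
suff -> : f = g by [].
apply/funext => s.
apply: eq_bigr => uv _; rewrite /germ big_split /=; congr (_ + _).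
  by apply: eq_bigr => j _; rewrite !mxE.
by apply: eq_bigr => j _; apply: eq_bigr => l _; rewrite mxE.
Qed.

(** * The quantitative estimate *)

Theorem theorem3p1 (R : realType) (gamma theta : R)
  (hgamma : 3^-1 < gamma <= 2^-1) (htheta : 0 < theta < 1)
  (hgt : theta < 2 * gamma) :
  exists r q : R, 0 < r /\ 0 < q /\
  forall (T : R) (m n : nat), 0 < T ->
  exists M : R,
  forall (X : R -> 'cV[R]_n) (XX : R -> R -> 'M[R]_n)
         (A : R -> 'M[R]_(m, n)) (A' : R -> 'M[R]_(m * n, n))
         (B : R -> 'cV[R]_m),
    rough_path T gamma X XX ->
    holder_rough T theta X ->
    controlled T gamma X (flatten_path A) A' ->
    (holder_norm T gamma B < +oo)%E ->
    let Z := fun t => rough_integral X XX A A' t + time_integral B t in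
    let RR := (1 + (roughness T theta X)^-1 + rough_path_norm T gamma X XX
               + controlled_norm T gamma X (flatten_path A) A'
               + holder_norm T gamma B)%E in
    (supnorm T A + supnorm T B <= M%:E * (RR `^ q) * (supnorm T Z `^ r))%E.
Proof.
pose k := Num.min (Num.min (2 * gamma - theta) (3 * gamma - 1)) gamma.
have k0 : 0 < k by rewrite !lt_min; lra.
have k1 : k <= 2 * gamma - theta by rewrite !ge_min lexx.
have k2 : k <= 3 * gamma - 1 by rewrite !ge_min lexx orbT.
have k3 : k <= gamma by rewrite !ge_min lexx orbT.
pose s0 := k / (1 + k).
have s00 : 0 < s0 by rewrite divr_gt0//; lra.
have r0 : 0 < s0 * s0 * s0 * s0.
  by have s2 := mulr_gt0 s00 s00; have s3 := mulr_gt0 s2 s00; exact: mulr_gt0.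
exists (s0 * s0 * s0 * s0), 11%:R; split=> //; split=> // T m n T0.
have [C0 C0p hC0] := row_integral n T hgamma.
have [C Cp hC] := row_estimate n hgamma htheta T0 C0p k0 k1 k2 k3.
rewrite -/s0 in hC.
set r := s0 * s0 * s0 * s0 in r0 hC *.
exists (1 + ((m * n)%:R + (m * 1)%:R) * C) => X XX A A' B hX hrough hA hB.
lazy zeta; set Z := fun t : R => rough_integral X XX A A' t + time_integral B t.
have [rho [r1 [RRE [[L [L0 hL Lr]] [hX' [hA' [sB hB']]]]]]] :=
  finite_norms T0 hX hrough hA hB.
rewrite RRE.
have rho0 : 0 <= rho by lra.
have C00 : 0 <= C by lra.
have M0 : 0 < 1 + ((m * n)%:R + (m * 1)%:R) * C :> R by rewrite ltr_wpDr// mulr_ge0.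
rewrite poweR_EFin powR_mulrn//.
have rq : 0 < rho ^+ 11 by rewrite exprn_gt0//; lra.
have Z0 := supnorm_ge0 Z T0.
case ZE : (supnorm T Z) Z0 => [z| |] Z0; last by [].
  2: by rewrite eqy_poweR// gt0_muley ?leey// -EFinM lte_fin mulr_gt0.
rewrite lee_fin in Z0.
have hz t i : t \in `[0, T] -> `|Z t i 0| <= z by apply: supnorm_le; rewrite ZE.
have est i s : s \in `[0, T] ->
    (forall j, `|A s i j| <= C * rho ^+ 11 * z `^ r) /\
    `|B s i 0| <= C * rho ^+ 11 * z `^ r.
  move=> sT.
  have rd := row_data_of_norms i T0 r1 hX hX' hA'.
  have [J [sJ hJ]] := hC0 _ _ _ _ _ r1 rd.
  have hb u : u \in `[0, T] -> `|B u i 0| <= rho by exact: (supnorm_le sB).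
  have hbh u v : u \in `[0, T] -> v \in `[0, T] ->
      `|B v i 0 - B u i 0| <= rho * `|v - u| `^ gamma.
    move=> uT vT; rewrite -increment_entry; apply: (holder2_le rho0 hB') => //.
    by move=> w x y _; rewrite increment_entry subrr.
  have g0 : 0 < gamma by lra.
  have hI := integral_primitive (holder_continuous g0 rho0 hbh).
  have hzt t : t \in `[0, T] ->
      `|J 0 t + \int[lebesgue_measure]_(u in `[0, t]) B u i 0| <= z.
    move=> tT; have := hz t i tT; rewrite mxE rough_integral_row hJ.
    - by rewrite mxE.
    - by move: tT; rewrite in_itv /= => /andP[].
    - by move: tT; rewrite in_itv /= => /andP[].
  have [ea eb] := hC _ _ _ _ _ _ _ _ _ _ r1 rd sJ hb hbh hI Z0 hzt hL L0 Lr s sT.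
  by split=> // j; have := ea j; rewrite !mxE.
pose w := C * rho ^+ 11 * z `^ r.
have w0 : 0 <= w by rewrite !mulr_ge0 ?powR_ge0// ltW.
have bA : (supnorm T A <= ((m * n)%:R * w)%:E)%E.
  by apply: supnorm_leP => s i j sT; exact: (est i s sT).1.
have bB : (supnorm T B <= ((m * 1)%:R * w)%:E)%E.
  by apply: supnorm_leP => s i j sT; rewrite ord1; exact: (est i s sT).2.
apply: (le_trans (leeD bA bB)); rewrite poweR_EFin -!EFinM -EFinD lee_fin.
have -> : (1 + ((m * n)%:R + (m * 1)%:R) * C) * rho ^+ 11 * z `^ r =
  rho ^+ 11 * z `^ r + ((m * n)%:R * w + (m * 1)%:R * w) by rewrite /w; ring.
by rewrite lerDr mulr_ge0 ?powR_ge0// ltW.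
Qed.
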